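(* The satisfiability problem and the finite satisfiability problem for modal inclusion logic $\mathcal{ML}(\subseteq)$ with lax semantics are $\mathrm{EXPTIME}$-hard with respect to polynomial-space ($\mathrm{PSPACE}$) reductions.
   Context: Let $\Pi$ be a countably infinite set of proposition symbols. Formulas of modal inclusion logic $\mathcal{ML}(\subseteq)$ are given by the grammar $\varphi ::= p \mid \neg p \mid (\varphi_1\wedge\varphi_2)\mid(\varphi_1\vee\varphi_2)\mid p_1\cdots p_k\subseteq q_1\cdots q_k \mid \Box\varphi\mid\Diamond\varphi$, where $p,p_i,q_i\in\Pi$ and $k\geq 1$. A Kripke model is $M=(W,R,V)$ with $W\neq\emptyset$, $R\subseteq W\times W$, $V:\Pi\to\mathcal{P}(W)$. A team is a subset $T\subseteq W$. Let $R(T)=\{s\in W\mid \exists s'\in T: (s',s)\in R\}$ and let $R\langle T\rangle$ be the set of all $T'\subseteq W$ such that every $s\in T$ has an $R$-successor in $T'$ and every $s'\in T'$ has an $R$-predecessor in $T$. Lax team semantics: $M,T\models p$ iff $T\subseteq V(p)$; $M,T\models\neg p$ iff $T\cap V(p)=\emptyset$; $M,T\models p_1\cdots p_k\subseteq q_1\cdots q_k$ iff for every $u\in T$ there is $v\in T$ with $u\in V(p_i)\Leftrightarrow v\in V(q_i)$ for all $i$; $M,T\models\varphi\wedge\psi$ iff both hold on $T$; $M,T\models\varphi\vee\psi$ iff there are $S,S'\subseteq T$ with $S\cup S'=T$, $M,S\models\varphi$, $M,S'\models\psi$; $M,T\models\Box\varphi$ iff $M,R(T)\models\varphi$; $M,T\models\Diamond\varphi$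 iff $M,T'\models\varphi$ for some $T'\in R\langle T\rangle$. The satisfiability problem asks whether there exist $M$ and a nonempty team $T$ with $M,T\models\varphi$; finite satisfiability additionally requires $W$ finite. *)

(* Defs.v *)
From HB Require Import structures.
From mathcomp Require Import all_boot.
From mathcomp Require Import boolp classical_sets cardinality.

Set Implicit Arguments.
Unset Strict Implicit.
Unset Printing Implicit Defensive.

(* The countably infinite set of proposition symbols is {p_w : w a binary
   word}; naming symbols by words fixes how they are written on a tape. *)
Definition psym : Type := seq bool.

Inductive form : Type :=
| Pos of psym
| Neg of psym
| And of form & form
| Or of form & form
| Incl k of k.+1.-tuple psym & k.+1.-tuple psym
| Box of form
| Dia of form.

Record kripke := Kripke {
  world : Type;
  world_inhabited : inhabited world;
  access : world -> world -> Prop;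
  valuation : psym -> set world }.

Section Semantics.
Local Open Scope classical_set_scope.
Variable M : kripke.
Implicit Types (T S : set (world M)) (phi : form).

Definition succs T : set (world M) :=
  [set s | exists2 s', T s' & access s' s].

Definition succ_teams T : set (set (world M)) :=
  [set T' | (forall s, T s -> exists2 s', T' s' & access s s') /\
            (forall s', T' s' -> exists2 s, T s & access s s')].

Fixpoint holds T phi {struct phi} : Prop :=
  match phi with
  | Pos p => T `<=` @valuation M p
  | Neg p => T `&` @valuation M p = set0
  | And f g => holds T f /\ holds T g
  | Or f g => exists S S' : set (world M),
      [/\ S `<=` T, S' `<=` T, S `|` S' = T, holds S f & holds S' g]
  | Incl _ ps qs => forall u, T u -> exists2 v, T v &
      forall i, valuation (tnth ps i) u <-> valuation (tnth qs i) v
  | Box f => holds (succs T) f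
  | Dia f => exists2 T', succ_teams T T' & holds T' f
  end.

End Semantics.

Definition satisfiable (phi : form) : Prop :=
  exists (M : kripke) (T : set (world M)), (T !=set0)%classic /\ holds T phi.

Definition fin_satisfiable (phi : form) : Prop :=
  exists (M : kripke) (T : set (world M)),
    [/\ finite_set [set: world M]%classic, (T !=set0)%classic & holds T phi].

Inductive token : Type :=
| TVar | TBit of bool | TNeg | TAnd | TOr | TBox | TDia | TOpen | TIncl | TClose.

Definition token_code (t : token) : option (option bool * 'I_8) :=
  match t with
  | TBit b => Some (Some b, ord0)
  | TVar => Some (None, inord 0)
  | TNeg => Some (None, inord 1)
  | TAnd => Some (None, inord 2)
  | TOr => Some (None, inord 3)
  | TBox => Some (None, inord 4)
  | TDia => Some (None, inord 5)
  | TOpen => Some (None, inord 6)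
  | TIncl => Some (None, inord 7)
  | TClose => None
  end.

Definition token_decode (c : option (option bool * 'I_8)) : token :=
  match c with
  | Some (Some b, _) => TBit b
  | Some (None, i) =>
      nth TClose [:: TVar; TNeg; TAnd; TOr; TBox; TDia; TOpen; TIncl] i
  | None => TClose
  end.

Lemma token_codeK : cancel token_code token_decode.
Proof. by case=> //=; rewrite inordK. Qed.

HB.instance Definition _ := Finite.copy token (can_type token_codeK).

Definition write_psym (p : psym) : seq token := TVar :: map TBit p.

(* Connectives are written in Polish notation, inclusion atoms as
   ( p1 ... pk <= q1 ... qk ). *)
Fixpoint write (phi : form) : seq token :=
  match phi with
  | Pos p => write_psym p
  | Neg p => TNeg :: write_psym p
  | And f g => TAnd :: write f ++ write g
  | Or f g => TOr :: write f ++ write g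
  | Incl _ ps qs => TOpen :: flatten (map write_psym ps) ++
                    TIncl :: flatten (map write_psym qs) ++ [:: TClose]
  | Box f => TBox :: write f
  | Dia f => TDia :: write f
  end.

Definition nobit (s : seq token) := if s is TBit _ :: _ then false else true.

Lemma write_psym_inj p q s t : nobit s -> nobit t ->
  write_psym p ++ s = write_psym q ++ t -> p = q /\ s = t.
Proof.
move=> hs ht [] {}/[dup] _; elim: p q => [|b p IH] [|c q] /=.
- by [].
- by move=> e; move: hs; rewrite e.
- by move=> e; move: ht; rewrite -e.
- by move=> [-> /IH[-> ->]].
Qed.

Definition novar (s : seq token) :=
  match s with TVar :: _ | TBit _ :: _ => false | _ => true end.

Lemma novar_nobit s : novar s -> nobit s.
Proof. by case: s => // -[]. Qed.

Lemma nobit_psyms ps s : novar s -> nobit (flatten (map write_psym ps) ++ s).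
Proof. by case: ps => //= /novar_nobit. Qed.

Lemma write_psyms_inj ps qs s t : novar s -> novar t ->
  flatten (map write_psym ps) ++ s = flatten (map write_psym qs) ++ t ->
  ps = qs /\ s = t.
Proof.
move=> hs ht; elim: ps qs => [|p ps IH] [|q qs] //.
- by move=> /= e; move: hs; rewrite e.
- by move=> /= e; move: ht; rewrite -e.
- rewrite (lock write_psym) /= -!lock -!catA.
  by case/write_psym_inj; rewrite ?nobit_psyms// => -> /IH[-> ->].
Qed.

Lemma nobit_write phi s : nobit (write phi ++ s).
Proof. by case: phi. Qed.

Lemma write_cat_inj phi psi s t : nobit s -> nobit t ->
  write phi ++ s = write psi ++ t -> phi = psi /\ s = t.
Proof.
elim: phi psi s t => [p|p|f IHf g IHg|f IHf g IHg|k ps qs|f IHf|f IHf]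
  [q|q|f' g'|f' g'|k' ps' qs'|f'|f'] s t hs ht //.
- by move=> /write_psym_inj[]// -> ->.
- by move=> [] e; have [] := @write_psym_inj p q s t hs ht; [rewrite /= e|move=> -> ->].
- rewrite /= -!catA => -[] /IHf[]; rewrite ?nobit_write// => ->.
  by move=> /IHg[]// -> ->.
- rewrite /= -!catA => -[] /IHf[]; rewrite ?nobit_write// => ->.
  by move=> /IHg[]// -> ->.
- rewrite /= -!catA /= => -[] /write_psyms_inj[]// eps [].
  rewrite -!catA => /write_psyms_inj[]// eqs [] ->.
  have ek : k = k' by have := congr1 size eps; rewrite !size_tuple => -[].
  subst k'.
  by split=> //; congr Incl; apply: val_inj.
- by move=> [] /IHf[]// -> ->.
- by move=> [] /IHf[]// -> ->.
Qed.

Lemma write_inj : injective write.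
Proof.
by move=> f g e; have [] := @write_cat_inj f g [::] [::] isT isT; rewrite ?e.
Qed.

Inductive move := Left | Stay | Right.

(* A machine has [ntapes.+1] two-way infinite tapes. Its tape symbols are the
   input letters A, the output letters B, finitely many work symbols and the
   blank [None]. It halts when the transition function is undefined. *)
Record machine (A B : finType) := Machine {
  ntapes : nat;
  work : finType;
  state : finType;
  start : state;
  delta : state -> {ffun 'I_ntapes.+1 -> option (A + B + work)} ->
          option (state * {ffun 'I_ntapes.+1 -> option (A + B + work) * move}) }.

(* [before] is listed from the head outwards; every cell beyond the listed ones
   is blank. A listed cell is never dropped, so the listed cells are those of
   the input together with those that have been visited. *)
Record tape (X : Type) := Tape { before : seq X; scanned : X; after : seq X }.

Definition tape_size X (t : tape X) := (size (before t) + size (after t)).+1.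

Definition contents X (t : tape X) := rev (before t) ++ scanned t :: after t.

Definition load X (w : seq (option X)) : tape (option X) :=
  if w is x :: w' then Tape [::] x w' else Tape [::] None [::].

Definition act X (t : tape (option X)) (a : option X * move) :
    tape (option X) :=
  let: Tape l _ r := t in let: (x, m) := a in
  match m with
  | Stay => Tape l x r
  | Left => if l is y :: l' then Tape l' y (x :: r) else Tape [::] None (x :: r)
  | Right => if r is y :: r' then Tape (x :: l) y r' else Tape (x :: l) None [::]
  end.

Section Runs.
Variables (A B : finType) (M : machine A B).

Definition symbol : Type := option (A + B + work M).

Record config := Config {
  cstate : state M;
  ctape : {ffun 'I_(ntapes M).+1 -> tape symbol} }.

Definition step (c : config) : option config :=
  if delta (cstate c) [ffun i => scanned (ctape c i)] is Some (q, a)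
  then Some (Config q [ffun i => act (ctape c i) (a i)]) else None.

Fixpoint run (n : nat) (c : config) : config :=
  if n is m.+1 then if step c is Some c' then run m c' else c else c.

Definition halted (c : config) : Prop := step c = None.

Definition init (x : seq A) : config :=
  Config (start M)
    [ffun i : 'I_(ntapes M).+1 =>
       load (if i == ord0 then [seq Some (inl (inl a)) | a <- x] else [::])].

(* The last tape holds the word y, surrounded by blanks only. *)
Definition outputs (c : config) (y : seq B) : Prop :=
  exists m n : nat, contents (ctape c ord_max) =
    nseq m None ++ [seq Some (inl (inr b)) | b <- y] ++ nseq n None.

Definition space (c : config) : nat := \sum_i tape_size (ctape c i).

End Runs.

(* Every polynomial is dominated by n ^ c + c for some c. *)
Definition poly_bound (c n : nat) : nat := n ^ c + c.

Definition EXPTIME (A : finType) (L : seq A -> Prop) : Prop :=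
  exists (M : machine A void) (accepting : pred (state M)) (c : nat),
    forall x : seq A,
      let final := run (2 ^ poly_bound c (size x)) (init M x) in
      halted final /\ (accepting (cstate final) <-> L x).

(* All tapes count towards the space, including the one carrying the output,
   so that the output has polynomial length. *)
Definition PSPACE_computable (A B : finType) (f : seq A -> seq B) : Prop :=
  exists (M : machine A B) (c : nat), forall x : seq A,
    (exists t, halted (run t (init M x)) /\ outputs (run t (init M x)) (f x)) /\
    (forall t, space (run t (init M x)) <= poly_bound c (size x)).

Definition PSPACE_reducible (A B : finType)
    (L : seq A -> Prop) (P : seq B -> Prop) : Prop :=
  exists f : seq A -> seq B,
    PSPACE_computable f /\ forall x, L x <-> P (f x).

Definition EXPTIME_hard_PSPACE (B : finType) (P : seq B -> Prop) : Prop :=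
  forall (A : finType) (L : seq A -> Prop), EXPTIME L -> PSPACE_reducible L P.

(* Words that write no formula are negative instances. *)
Definition problem (Q : form -> Prop) (w : seq token) : Prop :=
  exists2 phi, w = write phi & Q phi.

(* Main.v *)
(** Modalities are not needed.  A world is read as a claim (t, k, f), with t and
    k written in binary on D bits: "after t steps the state is q, the heads scan
    s, the cells k + 1 places to the left of the heads hold l, and the cells k
    places to their right hold r", where f = (k == 0, q, s, l, r) ranges over a finite set.
    Besides f itself, a world carries the data of its neighbours (t-1, k-1),
    (t-1, k), (t-1, k+1) and (t, k-1), and four inclusion atoms ask the team to
    contain these neighbours.  That a claim follows from its neighbours by one
    step of the machine is a propositional condition on every single world.
    Times and offsets are taken modulo K = 2^D: a nonempty team then contains a
    claim for (0, 0), whose neighbour is a claim for time K - 1, so acceptance is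
    the condition that a world with t = 0 has an accepting state at t - 1.
    All claims of the team with k + t < K are true, by induction on t and then
    on k; conversely, if the machine accepts, the finite team of all true claims
    satisfies the formula.

    Besides the inclusion atoms, the formula is a conjunction over i < D of one and
    the same template that depends on i and the i-th input letter only.  A machine
    writes it once it has a tape of length D = |x| + (|x| + 2)^(c+1) + 1, which it
    fills by running c + 1 nested loops.  Tapes never shrink, hence the space of
    a run is bounded by the space of its final configuration. *)

Require Import Defs.
From mathcomp Require Import all_boot.
From mathcomp Require Import boolp classical_sets cardinality.
From mathcomp Require Import zify.

Set Implicit Arguments.
Unset Strict Implicit.
Unset Printing Implicit Defensive.

(** * Formulas *)

Section Names.
Variable C : finType.

(** A one-hot code of [c], of length independent of [c], then [i] in unary: the word determines
    both, and a machine can write it by copying an index. It is never [[::]], which stays free for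
    the tests and the trivial pairs. *)
Definition name (c : C) (i : nat) : psym :=
  [seq c == b | b <- enum C] ++ nseq i.+1 true.

Lemma name_inj c i c' i' : name c i = name c' i' -> c = c' /\ i = i'.
Proof.
move=> e; have ei : i = i'.
  by have := congr1 size e; rewrite !size_cat !size_map !size_nseq => /addnI [].
split=> //; move: e; rewrite /name ei => /eqP.
rewrite eqseq_cat ?size_map// => /andP[/eqP /eq_in_map e _].
by apply/esym/eqP; rewrite -e ?mem_enum// eqxx.
Qed.

End Names.

(** * Modality-free formulas built from one template, and their team semantics *)

Section Formulas.
Variables (C letter : finType).

(* A schematic formula: [SLit _ c k] is about the symbol (c, 0), (c, i) or
   (c, i + 1) according to [k].  [STest P] is true or false depending on the
   letter; both versions have the same written length, as [Or p (~ p)] and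
   [And p (~ p)] differ in a single token. *)
Inductive sform :=
| SLit of bool & C & option bool
| STest of pred letter
| SAnd of sform & sform
| SOr of sform & sform.

Definition place (i : nat) (k : option bool) : nat :=
  if k is Some e then i + e else 0.

Fixpoint inst (i : nat) (s : letter) (g : sform) : form :=
  match g with
  | SLit b c k => (if b then Pos else Neg) (name c (place i k))
  | STest P => (if P s then Or else And) (Pos [::]) (Neg [::])
  | SAnd g h => And (inst i s g) (inst i s h)
  | SOr g h => Or (inst i s g) (inst i s h)
  end.

Fixpoint seval (v : C -> nat -> bool) (i : nat) (s : letter) (g : sform) : bool :=
  match g with
  | SLit b c k => v c (place i k) == b
  | STest P => P s
  | SAnd g h => seval v i s g && seval v i s h
  | SOr g h => seval v i s g || seval v i s h
  end.

Definition truth (M : kripke) (u : world M) (c : C) (i : nat) : bool :=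
  `[< valuation (name c i) u >].

(** These formulas contain neither modalities nor inclusion atoms, hence are flat. For a disjunction
    the team splits into the worlds satisfying either side. *)
Lemma holds_inst (M : kripke) (T : set (world M)) i s g :
  holds T (inst i s g) <-> (forall u, T u -> seval (truth u) i s g).
Proof.
elim: g T => [[] c k|P|g IHg h IHh|g IHg h IHh] T /=.
- by split=> H u /H; rewrite eqb_id => /asboolP.
- split=> [H u Tu|H]; rewrite ?eqbF_neg.
    by apply/asboolP => pu; have : set0 u by rewrite -H.
  apply/seteqP; split=> // u [Tu pu]; have := H u Tu.
  by rewrite eqbF_neg => /asboolP.
(* [And p (~ p)] holds on the empty team only; for [Or p (~ p)] the team is cut along [p]. *)
- case: (P s) => /=; last first.
    split=> [[TP Tn] u Tu|H].
      by exfalso; have : set0 u by rewrite -Tn; split => //; apply: TP.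
    by split=> [u /H//|]; apply/seteqP; split=> // u [/H].
  split=> // _; exists (T `&` @valuation M [::])%classic, (T `\` @valuation M [::])%classic.
  split; [by move=> u [] | by move=> u []| | by move=> u [] |].
    apply/seteqP; split=> [u [[]|[]]//|u Tu].
    by case: (pselect (valuation [::] u)) => ?; [left|right].
  by apply/seteqP; split=> // u [[]].
- split=> [[/IHg Hg /IHh Hh] u Tu|H]; first by rewrite Hg ?Hh.
  by split; [apply/IHg|apply/IHh] => u /H /andP[].
- split=> [[S [S' [ST S'T e /IHg Hg /IHh Hh]]] u|H].
    by rewrite -e => -[/Hg ->//|/Hh ->]; rewrite orbT.
  exists [set u | T u /\ seval (truth u) i s g]%classic.
  exists [set u | T u /\ seval (truth u) i s h]%classic.
  split; [by move=> u []|by move=> u []| |by apply/IHg => u []|by apply/IHh => u []].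
  apply/seteqP; split=> [u [[]|[]]//|u Tu].
  by have /orP[] := H u Tu; [left|right].
Qed.

Variable ok : letter -> {ffun C * option bool -> bool} -> bool.

(** The full disjunctive normal form of [ok], one disjunct per accepted letter and assignment. Its
    size is large but independent of the input word. *)
Definition dnf : sform :=
  foldr SOr (STest pred0)
    [seq foldr SAnd (STest (pred1 x.1))
           [seq SLit (x.2 a) a.1 a.2 | a <- enum {: C * option bool}]
    | x : letter * {ffun C * option bool -> bool}
        <- enum {: letter * {ffun C * option bool -> bool}}
      & ok x.1 x.2].

Lemma seval_dnf v i s :
  seval v i s dnf = ok s [ffun a => v a.1 (place i a.2)].
Proof.
have sE : forall l, seval v i s (foldr SOr (STest pred0) l) = has (seval v i s) l.
  by elim=> //= g l ->.
have aE : forall P l, seval v i s (foldr SAnd (STest P) l) = all (seval v i s) l && P s.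
  by move=> P; elim=> //= g l ->; rewrite andbA.
rewrite sE has_map; apply/hasP/idP => [[[s' e]]|ok_s].
  rewrite mem_filter /= => /andP[ok_e _]; rewrite aE all_map => /andP[/allP /= He /eqP ->].
  suff -> : [ffun a => v a.1 (place i a.2)] = e by [].
  by apply/ffunP => a; rewrite ffunE; apply/eqP/He; rewrite mem_enum.
exists (s, [ffun a => v a.1 (place i a.2)]).
  by rewrite mem_filter /= ok_s mem_enum.
by rewrite /= aE /= eqxx andbT all_map; apply/allP => a _ /=; rewrite ffunE.
Qed.

(* The trivial pair keeps the atom nonempty. *)
Definition incl (l : seq (psym * psym)) : form :=
  @Incl (size l) (map_tuple fst (in_tuple (([::], [::]) :: l)))
    (map_tuple snd (in_tuple (([::], [::]) :: l))).

Lemma holds_incl (M : kripke) (T : set (world M)) l :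
  holds T (incl l) <-> (forall u, T u -> exists2 v, T v &
     forall x, x \in ([::], [::]) :: l -> (valuation x.1 u <-> valuation x.2 v)).
Proof.
rewrite /incl /=; split=> H u /H [v Tv Hv]; exists v => //.
  move=> x xl; have i : index x (([::], [::]) :: l) < (size l).+1.
    by rewrite -[X in _ < X]/(size (([::], [::]) :: l)) index_mem.
  have := Hv (Ordinal i); rewrite !tnth_map (tnth_nth x) /=.
  by rewrite -[if _ then _ else _]/(index x (([::], [::]) :: l)) nth_index.
by move=> i; rewrite !tnth_map; apply: Hv; exact: mem_tnth.
Qed.

Variable rens : seq (seq C * (C -> C)).

(** Inside an inclusion atom these pairs ask for a world [v] whose own symbols [c] repeat what [u]
    stores under [x.2 c]. *)
Definition ren_pairs (n : nat) (x : seq C * (C -> C)) : seq (psym * psym) :=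
  flatten [seq [seq (name (x.2 c) i, name c i) | c <- x.1] | i <- iota 0 n].

Variable l0 : letter.

Definition phi (d : seq letter) : form :=
  foldr And (foldr And (inst 0 l0 (STest predT)) [seq incl (ren_pairs (size d) x) | x <- rens])
    [seq inst i (nth l0 d i) dnf | i <- iota 0 (size d)].

(** With [dnf_ok], the content of [phi] in terms of a boolean valuation alone; both directions of
    the correctness proof work with these two conditions. *)
Definition rens_ok (W : Type) (T : set W) (val : W -> C -> nat -> bool) n :=
  forall j, j < size rens -> forall u, T u -> exists2 v, T v &
    forall c i, c \in (nth ([::], id) rens j).1 -> i < n ->
      val u ((nth ([::], id) rens j).2 c) i = val v c i.

Definition dnf_ok (W : Type) (T : set W) (val : W -> C -> nat -> bool) d :=
  forall u, T u -> forall i, i < size d ->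
     ok (nth l0 d i) [ffun a => val u a.1 (place i a.2)].

Lemma holds_foldr_And (M : kripke) (T : set (world M)) (I : Type) g
    (F : I -> form) l (P : I -> Prop) :
  (forall i, holds T (F i) <-> P i) ->
  holds T (foldr And g [seq F i | i <- l]) <-> holds T g /\ (foldr (fun i Q => P i /\ Q) True l).
Proof.
move=> FP; elim: l => /= [|i l IH]; first by split=> // -[].
by rewrite FP IH; split=> [[? []]|[? []]].
Qed.

Lemma foldr_and_nth (I : Type) (x0 : I) (P : I -> Prop) l :
  foldr (fun i Q => P i /\ Q) True l <-> forall j, j < size l -> P (nth x0 l j).
Proof.
elim: l => //= i l IH; split=> [[Pi /IH Pl] [|j]//|H]; first exact: Pl.
by split; [exact: (H 0)|apply/IH => j; exact: (H j.+1)].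
Qed.

Lemma holds_phi (M : kripke) (T : set (world M)) d :
  holds T (phi d) -> dnf_ok T (@truth M) d /\ rens_ok T (@truth M) (size d).
Proof.
rewrite /phi (holds_foldr_And _ _ (fun i => holds_inst T i _ dnf)).
rewrite (holds_foldr_And _ _ (fun x => holds_incl T (ren_pairs (size d) x))).
case=> -[_ /(foldr_and_nth ([::], id)) rH] /(foldr_and_nth 0) dH; split=> [u Tu i id|j jr u Tu].
  have := dH i; rewrite size_iota => /(_ id u Tu).
  by rewrite nth_iota// seval_dnf add0n.
have [v Tv Hv] := rH j jr u Tu; exists v => // c i cS id.
apply/asbool_equiv_eq; apply: (Hv (name (_ c) i, name c i)).
rewrite in_cons; apply/orP; right; apply/flatten_mapP.
by exists i; rewrite ?mem_iota//; apply: map_f.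
Qed.

Lemma phi_fin_satisfiable (W : finType) (val : W -> C -> nat -> bool) d :
  W -> dnf_ok setT val d -> rens_ok setT val (size d) ->
  fin_satisfiable (phi d).
Proof.
move=> w0 dH rH.
(* Without modalities the accessibility relation may be empty. Only symbols of the form [name c i]
   are ever true. *)
pose M := @Kripke W (inhabits w0) (fun _ _ => False)
  (fun p u => exists c i, p = name c i /\ val u c i).
have tE (u : W) c i : @truth M u c i = val u c i.
  apply/asboolP/idP => [[c' [i' [/name_inj[-> ->]]]]//|H].
  by exists c, i.
exists M, setT; split; first exact: (@finite_finset W).
  by exists w0.
rewrite /phi (holds_foldr_And _ _ (fun i => holds_inst _ i _ dnf)).
rewrite (holds_foldr_And _ _ (fun x => holds_incl _ (ren_pairs (size d) x))).
split; last first.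
  apply/(foldr_and_nth 0) => i; rewrite size_iota => id u _.
  rewrite nth_iota// seval_dnf add0n; have := dH u I i id.
  by congr ok; apply/ffunP => a; rewrite !ffunE tE.
split; first by apply/holds_inst.
apply/(foldr_and_nth ([::], id)) => j jr u _.
have [v _ Hv] := rH j jr u I; exists v => // x.
rewrite in_cons => /orP[/eqP ->/=|/flatten_mapP [i]].
  (* The trivial pair: [[::]] is no name, so it is false at both worlds. *)
  by split=> -[c [i []]] /(congr1 size); rewrite size_cat size_nseq addnS.
rewrite mem_iota => id /mapP[c cS ->].
apply: asbool_eq_equiv.
by rewrite -[LHS]/(@truth M u _ _) -[RHS]/(@truth M v _ _) !tE; apply: Hv.
Qed.

End Formulas.

(** * Machines *)

Section Run.
Variables (A B : finType) (M : machine A B).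

(** [run] unfolds at the first step, whereas inductions on time need the last one. *)
Lemma runS n (c : config M) : run n.+1 c = odflt (run n c) (step (run n c)).
Proof.
elim: n c => [|n IH] c; first by rewrite /=; case: step.
have -> : run n.+2 c = if step c is Some c' then run n.+1 c' else c by [].
rewrite [run n.+1 c in RHS]/=; case E: (step c) => [c'|]; last by rewrite E.
exact: IH.
Qed.

Lemma run_halted n p (c : config M) : halted (run n c) -> run (n + p) c = run n c.
Proof. by move=> h; elim: p => [|p IH]; rewrite ?addn0// addnS runS IH h. Qed.

Lemma tape_size_act X (t : tape (option X)) a : tape_size t <= tape_size (act t a).
Proof. by case: t a => [[|? ?] s [|? ?]] [y []]; rewrite /tape_size /=; lia. Qed.

Lemma space_run n p (c : config M) : n <= p -> space (run n c) <= space (run p c).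
Proof.
move=> /subnKC <-; elim: (p - n) => [|q IH]; first by rewrite addn0.
apply: leq_trans IH _; rewrite addnS runS /step.
case: delta => [[q' a]|] //=; apply: leq_sum => i _; rewrite ffunE.
exact: tape_size_act.
Qed.

End Run.

(** * Composable programs on a fixed set of tapes *)

Section Programs.
Variables (N : nat) (A B W : finType).

Notation S := (option (A + B + W)).
Notation vec := {ffun 'I_N.+1 -> S}.
Notation tapes := {ffun 'I_N.+1 -> tape S}.
Notation action := {ffun 'I_N.+1 -> S * move}.

Record prog := Prog {
  pstate : finType;
  pstart : pstate;
  ptrans : pstate -> vec -> option (pstate * action) }.

Definition to_machine (P : prog) : machine A B :=
  @Machine A B N W (pstate P) (pstart P) (@ptrans P).

Definition scans (t : tapes) : vec := [ffun i => scanned (t i)].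
Definition acts (t : tapes) (a : action) : tapes := [ffun i => act (t i) (a i)].
Definition stay (v : vec) : action := [ffun i => (v i, Stay)].

Lemma acts_stay t : acts t (stay (scans t)) = t.
Proof. by apply/ffunP => i; rewrite !ffunE; case: (t i). Qed.

(** Terminating executions without a step count: the space bound needs only termination and the
    final tapes. *)
Inductive exec_from (P : prog) : pstate P -> tapes -> tapes -> Prop :=
| ExecHalt q t : ptrans q (scans t) = None -> exec_from q t t
| ExecStep q t q' a t' : ptrans q (scans t) = Some (q', a) ->
    exec_from q' (acts t a) t' -> exec_from q t t'.

Definition exec (P : prog) : tapes -> tapes -> Prop := exec_from (pstart P).

Lemma exec_run P t t' : exec P t t' ->
  exists n (c : config (to_machine P)),
    [/\ run n (@Config A B (to_machine P) (pstart P) t) = c, halted c & ctape c = t'].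
Proof.
rewrite /exec; elim=> {t t'} [q t qN|q t q' a t' qS _ [n [c [rn hc ec]]]].
  exists 0; eexists; split; first by [].
  - by rewrite /halted /step /= -/(scans t) qN.
  - by [].
exists n.+1, c; split=> //=.
by rewrite /step /= -/(scans t) qS.
Qed.

Definition pact (g : vec -> action) : prog :=
  @Prog bool true (fun q v => if q then Some (false, g v) else None).

Lemma exec_act g t : exec (pact g) t (acts t (g (scans t))).
Proof. by apply: ExecStep; [reflexivity|exact: ExecHalt]. Qed.

Definition pskip : prog := @Prog unit tt (fun _ _ => None).

Lemma exec_skip t : exec pskip t t.
Proof. exact: ExecHalt. Qed.

(** Where [P] would halt, one extra step leaves the tapes unchanged and passes control to [Q];
    [pwhile] returns to its test in the same way. *)
Definition pseq (P Q : prog) : prog :=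
  @Prog (pstate P + pstate Q)%type (inl (pstart P)) (fun q v =>
    match q with
    | inl p => Some (if ptrans p v is Some (p', a) then (inl p', a)
                     else (inr (pstart Q), stay v))
    | inr p => if ptrans p v is Some (p', a) then Some (inr p', a) else None
    end).

Lemma exec_seq P Q t1 t2 t3 : exec P t1 t2 -> exec Q t2 t3 -> exec (pseq P Q) t1 t3.
Proof.
move=> eP eQ.
have {}eQ : @exec_from (pseq P Q) (inr (pstart Q)) t2 t3.
  move: eQ; rewrite /exec; elim=> [q t e|q t q' a t' e _ IH].
    by apply: ExecHalt; rewrite /= e.
  by apply: ExecStep IH; rewrite /= e.
rewrite /exec /=; move: eP eQ; rewrite /exec; elim=> [q t e|q t q' a t' e _ IH] eQ.
  apply: (@ExecStep (pseq P Q) (inl q) t (inr (pstart Q)) (stay (scans t)));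
    by rewrite /= ?e ?acts_stay.
by apply: ExecStep (IH eQ); rewrite /= e.
Qed.

Definition pwhile (b : vec -> bool) (P : prog) : prog :=
  @Prog (option (pstate P)) None (fun q v =>
    match q with
    | None => if b v then Some (Some (pstart P), stay v) else None
    | Some p => Some (if ptrans p v is Some (p', a) then (Some p', a)
                      else (None, stay v))
    end).

Lemma exec_while_done (b : vec -> bool) P t : ~~ b (scans t) -> exec (pwhile b P) t t.
Proof. by move=> /negbTE nb; apply: ExecHalt; rewrite /= nb. Qed.

Lemma exec_while (b : vec -> bool) P t1 t2 t3 : b (scans t1) -> exec P t1 t2 ->
  exec (pwhile b P) t2 t3 -> exec (pwhile b P) t1 t3.
Proof.
move=> bt eP eW; rewrite /exec /=.
apply: (@ExecStep (pwhile b P) None t1 (Some (pstart P)) (stay (scans t1))); first by rewrite /= bt.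
rewrite acts_stay; move: eP eW; rewrite /exec.
elim=> [q t e|q t q' a t' e _ IH] eW.
  by apply: (@ExecStep (pwhile b P) (Some q) t None (stay (scans t))); rewrite /= ?e ?acts_stay.
by apply: ExecStep (IH eW); rewrite /= e.
Qed.

Definition upd (t : tapes) i x : tapes := [ffun j => if j == i then x else t j].

Lemma updE (t : tapes) i x : upd t i x i = x. Proof. by rewrite ffunE eqxx. Qed.
Lemma updN (t : tapes) i x j : j != i -> upd t i x j = t j.
Proof. by rewrite ffunE => /negbTE ->. Qed.
Lemma updK (t : tapes) i x y : upd (upd t i x) i y = upd t i y.
Proof. by apply/ffunP => j; rewrite !ffunE; case: eqP. Qed.
Lemma updC (t : tapes) i j x y : i != j -> upd (upd t i x) j y = upd (upd t j y) i x.
Proof.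
move=> ij; apply/ffunP => l; rewrite !ffunE.
by case: (eqVneq l j) => // ->; rewrite eq_sym (negbTE ij).
Qed.
Lemma upd_id (t : tapes) i x : t i = x -> upd t i x = t.
Proof. by move=> <-; apply/ffunP => j; rewrite ffunE; case: eqP => // ->. Qed.

Definition on (i : 'I_N.+1) (h : S -> S * move) : prog :=
  pact (fun v => [ffun j => if j == i then h (v i) else (v j, Stay)]).

Lemma exec_on i h (t : tapes) x : t i = x -> exec (on i h) t (upd t i (act x (h (scanned x)))).
Proof.
move=> <-; have := exec_act (fun v => [ffun j => if j == i then h (v i) else (v j, Stay)]) t.
congr exec_from; apply/ffunP => j; rewrite !ffunE.
by case: eqP => [->//|_]; case: (t j).
Qed.

(* The word [p ++ q] followed by blanks, with the head on the first cell of [q]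
   and the reversed word [b] to its left. *)
Definition zip_tape X (b p q : seq (option X)) : tape (option X) :=
  Tape (rev p ++ b) (head None q) (behead q).

Lemma zip_right X (b p q : seq (option X)) s :
  act (zip_tape b p q) (s, Right) = zip_tape b (rcons p s) (behead q).
Proof. by rewrite /zip_tape rev_rcons; case: q => [|? []]. Qed.

Lemma zip_left X (b p q : seq (option X)) y s :
  act (zip_tape b (rcons p y) q) (s, Left) = zip_tape b p (y :: s :: behead q).
Proof. by rewrite /zip_tape rev_rcons. Qed.

Lemma zip_stay X (b p q : seq (option X)) s :
  act (zip_tape b p q) (s, Stay) = zip_tape b p (s :: behead q).
Proof. by []. Qed.

(** The scanned cell is always listed, even if it is blank. *)
Lemma zip_blank X (b p : seq (option X)) : zip_tape b p [::] = zip_tape b p [:: None].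
Proof. by []. Qed.

Definition keep (m : move) (s : S) : S * move := (s, m).

Lemma exec_left_to i (b : pred S) h (t : tapes) p q : ~~ b h ->
  t i = zip_tape [:: h] p q -> all b (head None q :: p) ->
  exec (pwhile (fun v => b (v i)) (on i (keep Left))) t
    (upd t i (zip_tape [::] [::] (h :: p ++ head None q :: behead q))).
Proof.
move=> bh; elim/last_ind: p q t => [|p y IH] q t ti /=.
  rewrite andbT => bq; apply: exec_while; first by rewrite ffunE ti.
    exact: exec_on ti.
  by apply: exec_while_done; rewrite !ffunE eqxx.
rewrite all_rcons => /and3P[bq b_y bp]; apply: exec_while; first by rewrite ffunE ti.
  exact: exec_on ti.
rewrite /keep zip_left; set t' := upd _ _ _.
have := IH (y :: head None q :: behead q) t'; rewrite updE /= b_y bp => /(_ erefl isT).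
by rewrite updK cat_rcons.
Qed.

Lemma exec_right_to i (b : pred S) (t : tapes) l p q r : ~~ b (head None r) ->
  t i = zip_tape l p (q ++ r) -> all b q ->
  exec (pwhile (fun v => b (v i)) (on i (keep Right))) t
    (upd t i (zip_tape l (p ++ q) r)).
Proof.
move=> br; elim: q p t => [|y q IH] p t ti /=.
  move=> _; rewrite cats0 (upd_id ti).
  by apply: exec_while_done; rewrite ffunE ti.
case/andP=> b_y bq; apply: exec_while; first by rewrite ffunE ti.
  exact: exec_on ti.
rewrite /keep zip_right; set t' := upd _ _ _.
have := IH (rcons p y) t'; rewrite updE /= bq => /(_ erefl isT).
by rewrite updK cat_rcons.
Qed.

Definition rewind (i : 'I_N.+1) (h : S) : prog :=
  pseq (pwhile (fun v => v i != h) (on i (keep Left))) (on i (keep Right)).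

Lemma exec_rewind i h (t : tapes) p s q : t i = zip_tape [:: h] p (s :: q) -> h \notin s :: p ->
  exec (rewind i h) t (upd t i (zip_tape [:: h] [::] (p ++ s :: q))).
Proof.
move=> ti hp; apply: exec_seq.
  apply: (@exec_left_to i (fun y => y != h)) ti _; first by rewrite eqxx.
  by apply/allP => y yp; apply: contraNneq hp => <-.
have := @exec_on i (keep Right) _ _ (updE t i (zip_tape [::] [::] (h :: p ++ s :: q))).
by rewrite updK /keep zip_right.
Qed.

End Programs.

(** * Simulating a computation *)

Definition bit (i a : nat) : bool := odd (a %/ 2 ^ i).
(** The carry into position [i] when 1 is added to [a]: the [i] lowest bits of [a] are all ones. *)
Definition carry (i a : nat) : bool := 2 ^ i %| a.+1.
Definition next (K a : nat) : nat := if a.+1 == K then 0 else a.+1.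
Definition prev (K a : nat) : nat := if a is b.+1 then b else K.-1.

Lemma carryS i a : carry i.+1 a = bit i a && carry i a.
Proof.
rewrite /carry /bit expnS.
have [/dvdnP[q e]|nd] /= := boolP (2 ^ i %| a.+1); last first.
  by rewrite andbF; apply: contraNF nd => /(dvdn_trans _)->//; exact: dvdn_mull.
have p0 : 0 < 2 ^ i by rewrite expn_gt0.
have := divnS a p0; rewrite e dvdn_mull// mulnK// => eq.
by rewrite dvdn_pmul2r// dvdn2 eq andbT /= negbK.
Qed.

Lemma bit_next D i a : i < D -> bit i (next (2 ^ D) a) = bit i a (+) carry i a.
Proof.
move=> iD; have p0 : 0 < 2 ^ i by rewrite expn_gt0.
have -> : bit i (next (2 ^ D) a) = bit i a.+1.
  (* At the wraparound, [2 ^ D] and 0 agree in all bits below [D]. *)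
  rewrite /next; case: eqP => // ->; rewrite /bit div0n.
  by rewrite -expnB 1?ltnW// oddX subn_eq0 leqNgt iD.
by rewrite /bit divnS// oddD addbC /carry; case: (_ %| _).
Qed.

Lemma nextK K a : a < K -> prev K (next K a) = a.
Proof. by rewrite /next; case: eqP => // <-. Qed.

Lemma prevK K a : a < K -> next K (prev K a) = a.
Proof.
case: a => [|a] aK; rewrite /next /prev; first by rewrite prednK// eqxx.
by rewrite (ltn_eqF aK).
Qed.

(** The increment leading to [a] overflows exactly for [a = 0]; thus a final carry becomes a zero
    flag. *)
Lemma prev_wrap K a : a < K -> ((prev K a).+1 == K) = (a == 0).
Proof. by case: a => [|a] aK; rewrite /= ?prednK ?eqxx ?(ltn_eqF aK). Qed.

Lemma prev_lt K a : a < K -> prev K a < K.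
Proof. by case: a => [|a] /=; [case: K|apply: ltnW]. Qed.

Lemma next_lt K a : a < K -> next K a < K.
Proof. by rewrite /next => aK; case: eqP => [<-//|/eqP ne]; rewrite ltn_neqAle ne. Qed.

Definition bits_value (b : nat -> bool) (D : nat) : nat := \sum_(i < D) b i * 2 ^ i.

Lemma bits_value_lt b D : bits_value b D < 2 ^ D.
Proof.
elim: D => [|D IH]; first by rewrite /bits_value big_ord0.
rewrite /bits_value big_ord_recr /= -/(bits_value b D) expnS; case: (b D); lia.
Qed.

(** The incoming carry [c 0] is the 1 that is added. The equation is an invariant of the number of
    low bits processed so far. *)
Lemma adder_value (x y c : nat -> bool) D : c 0 ->
  (forall i, i < D -> x i = y i (+) c i /\ c i.+1 = y i && c i) ->
  bits_value x D + c D * 2 ^ D = (bits_value y D).+1.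
Proof.
move=> c0 H; suff : forall E, E <= D ->
  bits_value x E + c E * 2 ^ E = (bits_value y E).+1 by apply.
elim=> [|E IH] ED; first by rewrite /bits_value !big_ord0 c0.
move: (IH (ltnW ED)) (H E ED) => {IH}.
rewrite /bits_value !big_ord_recr /= -!/(bits_value _ E) expnS => IH [-> ->].
by move: IH; case: (y E); case: (c E) => /=; lia.
Qed.

Lemma adder_next (x y c : nat -> bool) D : c 0 ->
  (forall i, i < D -> x i = y i (+) c i /\ c i.+1 = y i && c i) ->
  bits_value x D = next (2 ^ D) (bits_value y D) /\
  c D = ((bits_value y D).+1 == 2 ^ D).
Proof.
move=> c0 H; have := adder_value c0 H.
have := bits_value_lt x D; have := bits_value_lt y D.
rewrite /next; case: (c D); rewrite ?mul1n ?mul0n; case: eqP; lia.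
Qed.

(** * The local rule between neighbouring claims, and the formula that expresses it *)

Section Simulation.
Variables (A : finType) (M : machine A void) (acc : pred (state M)).

(** [Some (Some a)] is an input letter, [Some None] is padding, [None] marks the last position. *)
Definition letter : Type := option (option A).

Definition scan : Type := {ffun 'I_(ntapes M).+1 -> option (A + void + work M)}.

Definition datum : Type := (bool * state M * scan * (scan * scan))%type.

Definition origin (f : datum) : bool := f.1.1.1.
Definition dstate (f : datum) : state M := f.1.1.2.
Definition dscan (f : datum) : scan := f.1.2.
Definition dleft (f : datum) : scan := f.2.1.
Definition dright (f : datum) : scan := f.2.2.

(** A halted machine keeps its configuration, in agreement with [run]; [new_left] and [new_right] do
    the same. *)
Definition new_state (f : datum) : state M :=
  if delta (dstate f) (dscan f) is Some (q, _) then q else dstate f.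

(** Here [f1], [f2], [f3] are the data at time t - 1 and offsets k - 1, k, k + 1. After a move to
    the right the nearest cell on the left, k = 0, is the one just written. *)
Definition new_left (z : bool) (f1 f2 f3 : datum) : scan :=
  if delta (dstate f2) (dscan f2) is Some (_, a) then
    [ffun i => match (a i).2 with
       | Left => dleft f3 i
       | Stay => dleft f2 i
       | Right => if z then (a i).1 else dleft f1 i
       end]
  else dleft f2.

(** Offset 0 on this side is the scanned cell, which the step overwrites; [written] reads a cell
    after this change. *)
Definition new_right (z : bool) (f1 f2 f3 : datum) : scan :=
  if delta (dstate f2) (dscan f2) is Some (_, a) then
    [ffun i => let written f := if origin f then (a i).1 else dright f i in
       match (a i).2 with
       | Left => if z then dleft f2 i else written f1
       | Stay => written f2
       | Right => dright f3 i
       end]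
  else dright f2.

(* [zt], [zk] and [mk] stand for t = 0, k = 0 and k = K - 1.  The step is not
   checked at k = K - 1, where k + 1 wraps around. *)
Definition rule (zt zk mk : bool) (f0 f1 f2 f3 f4 : datum) : bool :=
  [&& origin f0 == zk,
      if zk then dscan f0 == dright f0
      else (dstate f0 == dstate f4) && (dscan f0 == dscan f4) &
      if zt then
        [&& acc (dstate f2), dstate f0 == start M, dleft f0 == [ffun=> None],
            [forall i, (i != ord0) ==> (dright f0 i == None)] &
            ~~ zk && (dright f4 ord0 == None) ==> (dright f0 ord0 == None)]
      else mk || [&& dstate f0 == new_state f2,
                     dleft f0 == new_left (origin f0) f1 f2 f3 &
                     dright f0 == new_right (origin f0) f1 f2 f3]].

Lemma datum_eq f g : origin f = origin g -> dstate f = dstate g ->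
  dscan f = dscan g -> dleft f = dleft g -> dright f = dright g -> f = g.
Proof.
case: f g => [[[z q] s] [l r]] [[[z' q'] s'] [l' r']].
by rewrite /origin /dstate /dscan /dleft /dright /= => -> -> -> -> ->.
Qed.

Section Truth.
Variable x : seq A.

Definition conf (t : nat) : config M := run t (init M x).

Definition lcell X (t : tape (option X)) (k : nat) := nth None (before t) k.
Definition rcell X (t : tape (option X)) (k : nat) := nth None (scanned t :: after t) k.

Definition claim (t k : nat) : datum :=
  (k == 0, cstate (conf t), [ffun i => scanned (ctape (conf t) i)],
   ([ffun i => lcell (ctape (conf t) i) k], [ffun i => rcell (ctape (conf t) i) k])).

Lemma lcell_act X (t : tape (option X)) a k : lcell (act t a) k =
  match a.2 with
  | Left => lcell t k.+1
  | Stay => lcell t k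
  | Right => if k is k'.+1 then lcell t k' else a.1
  end.
Proof.
case: t a => l s r [y []]; rewrite /lcell; case: k => [|k] //=.
- by case: l.
- by case: l => //=; rewrite nth_nil.
- by case: r.
- by case: r.
Qed.

Lemma rcell_act X (t : tape (option X)) a k : rcell (act t a) k =
  match a.2 with
  | Left => if k is k'.+1 then if k' is _.+1 then rcell t k' else a.1 else lcell t k
  | Stay => if k is _.+1 then rcell t k else a.1
  | Right => rcell t k.+1
  end.
Proof.
case: t a => l s r [y []]; rewrite /lcell /rcell.
- by case: l k => [|? ?] [|[|k]].
- by case: k.
- by case: r k => [|? ?] [|k] //=; rewrite nth_nil.
Qed.

Lemma new_state_claim t k : new_state (claim t k) = cstate (conf t.+1).
Proof.
rewrite /conf runS /step /new_state /dstate /dscan /=.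
by case: delta => [[]|].
Qed.

(** At [k = 0] the offset k - 1 wraps around, so [f1] is arbitrary there; [new_left] reads it for
    positive [k] only. *)
Lemma new_left_claim t k f1 : (0 < k -> f1 = claim t k.-1) ->
  new_left (k == 0) f1 (claim t k) (claim t k.+1) = dleft (claim t.+1 k).
Proof.
move=> e1; rewrite /conf /new_left /dleft /dstate /dscan /= /conf runS /step.
case E: delta => [[q a]|] //=; apply/ffunP => i; rewrite !ffunE lcell_act.
case: (a i) => y [] //=; case: k e1 => [|k] //= ->//.
by rewrite /= ffunE.
Qed.

Lemma new_right_claim t k f1 : (0 < k -> f1 = claim t k.-1) ->
  new_right (k == 0) f1 (claim t k) (claim t k.+1) = dright (claim t.+1 k).
Proof.
move=> e1; rewrite /conf /new_right /dright /dstate /dscan /= /conf runS /step.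
case E: delta => [[q a]|] //=; apply/ffunP => i; rewrite !ffunE rcell_act /dleft /origin /=.
case: (a i) => y [] //=; case: k e1 => [|k] //= e1; rewrite ?e1 //= ffunE.
by case: k e1.
Qed.

End Truth.

Definition tag : Type := 'I_13.
Definition class : Type := (tag + 'I_5 * datum)%type.
Definition tg n (h : n < 13) : class := inl (Ordinal h).
Notation tag_ n := (tg (n := n) isT).
Notation nbr n := (@Ordinal 5 n isT).

(* x = y + 1 modulo K, with carries c; the final carry is copied to [flag]. *)
Definition adder_ok (s : letter) (e : {ffun class * option bool -> bool})
    (x y c flag : class) : bool :=
  [&& e (c, None), e (x, Some false) == e (y, Some false) (+) e (c, Some false),
      e (c, Some true) == e (y, Some false) && e (c, Some false) &
      (s == None) ==> (e (flag, None) == e (c, Some true))].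

Definition input_letter (s : letter) : option (A + void + work M) :=
  if s is Some (Some a) then Some (inl (inl a)) else None.

(* Bits of t, t-1, k, k-1 and k+1; carries for t-1, k-1 and k; unary flags
   k = i and k-1 = i; flags t = 0, k = 0 and k = K-1. *)
Notation Bt := (tag_ 0). Notation Bt' := (tag_ 1).
Notation Bk := (tag_ 2). Notation Bm := (tag_ 3). Notation Bp := (tag_ 4).
Notation Ct := (tag_ 5). Notation Cm := (tag_ 6). Notation Cp := (tag_ 7).
Notation Pk := (tag_ 8). Notation Pm := (tag_ 9).
Notation Zt := (tag_ 10). Notation Zk := (tag_ 11). Notation Mk := (tag_ 12).

(** The conditions at one position i. Unary flags follow the recursion: k = i + 1 iff k is nonzero
    and k - 1 = i. The five data are one-hot coded at place 0, so their rule is the same at every i;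
    only the comparison with the input letter, at t = 0 and k = i, depends on i. *)
Definition sim_ok (s : letter) (e : {ffun class * option bool -> bool}) : bool :=
  [&& adder_ok s e Bt Bt' Ct Zt, adder_ok s e Bk Bm Cm Zk, adder_ok s e Bp Bk Cp Mk,
      e (Pk, None) == e (Zk, None),
      e (Pk, Some true) == ~~ e (Zk, None) && e (Pm, Some false) &
      [exists f : {ffun 'I_5 -> datum},
        [&& [forall g, forall h, e (inr (g, h), None) == (f g == h)],
            rule (e (Zt, None)) (e (Zk, None)) (e (Mk, None))
              (f (nbr 0)) (f (nbr 1)) (f (nbr 2)) (f (nbr 3)) (f (nbr 4)) &
            e (Zt, None) && e (Pk, Some false) ==>
              (dright (f (nbr 0)) ord0 == input_letter s)]]].

(** Where a world stores the symbol [c] of its neighbour [g]: time and offset in [bt] and [bk], the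
    data in block [g], the unary flags in [Pm]. *)
Definition redirect (bt bk : class) (g : 'I_5) (c : class) : class :=
  match c with
  | inl i => if c == Bt then bt else if c == Bk then bk else Pm
  | inr (_, h) => inr (g, h)
  end.

(** The neighbours (t-1, k-1), (t-1, k), (t-1, k+1) and (t, k-1). Only the last one passes on unary
    flags, which are determined by recursion on k. *)
Definition sim_rens : seq (seq class * (class -> class)) :=
  let S := Bt :: Bk :: [seq inr (nbr 0, h) | h <- enum {: datum}] in
  [:: (S, redirect Bt' Bm (nbr 1)); (S, redirect Bt' Bk (nbr 2));
      (S, redirect Bt' Bp (nbr 3)); (Pk :: S, redirect Bt Bm (nbr 4))].

Definition sim_formula (d : seq letter) : form := phi sim_ok sim_rens None d.

(* The last letter is distinguished so that the template can end the carries. *)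
Definition padded (x : seq A) (m : nat) : seq letter :=
  [seq Some (Some a) | a <- x] ++ nseq m (Some None) ++ [:: None].

Section Correctness.
Variables (x : seq A) (m : nat).
Let d := padded x m.
Let D := size d.
Let K := 2 ^ D.

Lemma size_padded : D = (size x + m).+1.
Proof. by rewrite /D size_cat size_map size_cat size_nseq addn1 addnS. Qed.

Lemma nth_padded_last i : i < D -> (nth None d i == None) = (i == D.-1).
Proof.
rewrite size_padded ltnS => iD; rewrite /d /padded !nth_cat size_map size_nseq.
case: ltnP => [ix|xi].
  by case: x ix => // a y ix; rewrite (nth_map a) //; apply/esym/negbTE; lia.
case: ltnP => mi; first by rewrite nth_nseq mi; apply/esym/negbTE; lia.
have -> : i - size x - m = 0 by lia.
by rewrite eqxx; apply/esym; lia.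
Qed.

Lemma input_padded i : input_letter (nth None d i) =
  rcell (ctape (conf x 0) ord0) i.
Proof.
rewrite /conf /= ffunE eqxx /d /padded.
case: (x) => [|a y]; rewrite /rcell /=.
  have -> : nth None [:: None] i = None :> option (A + void + work M) by case: i => [|[]].
  rewrite nth_cat nth_nseq size_nseq; case: ifP => _; first by case: ifP.
  by case: (i - m) => [|[|?]].
case: i => [|i] //=; rewrite nth_cat size_map; case: ltnP => iy.
  by rewrite !(nth_map a).
rewrite [RHS]nth_default ?size_map// nth_cat nth_nseq size_nseq.
case: ifP => _; first by case: ifP.
by case: (_ - _ - _) => [|[|?]].
Qed.

(** * Soundness: a nonempty team forces acceptance *)

Section Soundness.
Variables (W : Type) (T : set W) (val : W -> class -> nat -> bool).
Hypothesis dnfT : dnf_ok sim_ok None T val d.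
Hypothesis rensT : rens_ok sim_rens T val D.

Let D0 : 0 < D. Proof. by rewrite size_padded. Qed.
Let DD : D.-1 < D. Proof. by rewrite prednK. Qed.
Let num u c := bits_value (val u c) D.

Lemma okT u i : T u -> i < D ->
  sim_ok (nth None d i) [ffun a => val u a.1 (place i a.2)].
Proof. by move=> Tu; exact: dnfT. Qed.

Lemma adderT u x' y c flag : T u ->
  (forall i, i < D ->
     adder_ok (nth None d i) [ffun a => val u a.1 (place i a.2)] x' y c flag) ->
  num u x' = next K (num u y) /\ val u flag 0 = ((num u y).+1 == K).
Proof.
move=> Tu H; have [] := @adder_next (val u x') (val u y) (val u c) D.
- by have /and4P[] := H 0 D0; rewrite !ffunE.
- move=> i /H /and4P[_ /eqP + /eqP + _]; rewrite !ffunE /= addn0 addn1.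
  by split.
- move=> e1 e2; split; first exact: e1.
  rewrite -[RHS]e2.
  (* The final letter sits at position [D.-1], where the outgoing carry, at place [D], is copied to
     the flag. *)
  have /and4P[_ _ _] := H _ DD; rewrite nth_padded_last// eqxx /= => /eqP.
  by rewrite !ffunE /= addn1 prednK.
Qed.

Lemma numT u : T u ->
  [/\ num u Bt' = prev K (num u Bt), num u Bm = prev K (num u Bk) &
      num u Bp = next K (num u Bk)].
Proof.
move=> Tu.
have [et _] := adderT Tu (fun i iD => proj1 (andP (okT Tu iD))).
have [ek _] := adderT Tu (fun i iD => proj1 (andP (proj2 (andP (okT Tu iD))))).
have [ep _] := adderT Tu (fun i iD =>
   proj1 (andP (proj2 (andP (proj2 (andP (okT Tu iD))))))).
by split=> //; [rewrite et|rewrite ek]; rewrite nextK// bits_value_lt.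
Qed.

Lemma flagT u : T u ->
  [/\ val u Zt 0 = (num u Bt == 0), val u Zk 0 = (num u Bk == 0) &
      val u Mk 0 = ((num u Bk).+1 == K)].
Proof.
move=> Tu; have [eb em ep] := numT Tu.
have [_ et] := adderT Tu (fun i iD => proj1 (andP (okT Tu iD))).
have [_ ek] := adderT Tu (fun i iD => proj1 (andP (proj2 (andP (okT Tu iD))))).
have [_ epp] := adderT Tu (fun i iD =>
   proj1 (andP (proj2 (andP (proj2 (andP (okT Tu iD))))))).
by rewrite et ek epp eb em; split=> //; rewrite prev_wrap// bits_value_lt.
Qed.

Definition decodes u (f : 'I_5 -> datum) :=
  forall g h, val u (inr (g, h)) 0 = (f g == h).

Lemma ruleT u : T u -> exists f,
  [/\ decodes u f,
      rule (num u Bt == 0) (num u Bk == 0) ((num u Bk).+1 == K)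
        (f (nbr 0)) (f (nbr 1)) (f (nbr 2)) (f (nbr 3)) (f (nbr 4)) &
      forall i, i < D -> num u Bt = 0 -> val u Pk i ->
        dright (f (nbr 0)) ord0 = rcell (ctape (conf x 0) ord0) i].
Proof.
move=> Tu; have [ft fk fm] := flagT Tu.
have H i : i < D -> exists f,
  [/\ decodes u f,
      rule (num u Bt == 0) (num u Bk == 0) ((num u Bk).+1 == K)
        (f (nbr 0)) (f (nbr 1)) (f (nbr 2)) (f (nbr 3)) (f (nbr 4)) &
      num u Bt = 0 -> val u Pk i ->
        dright (f (nbr 0)) ord0 = input_letter (nth None d i)].
  move=> iD; have := okT Tu iD; rewrite /sim_ok.
  do 5!case/andP=> _; case/existsP=> f; rewrite !ffunE /= addn0 ft fk fm.
  case/and3P=> /forallP fd fr /implyP fi; exists f; split=> //.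
    by move=> g h; have /forallP/(_ h)/eqP := fd g; rewrite !ffunE.
  by move=> t0 pk; apply/eqP/fi; rewrite t0 pk.
have [f [fd fr _]] := H 0 D0; exists f; split=> // i iD t0 pk.
have [f' [fd' _ fi]] := H i iD; rewrite -input_padded -(fi t0 pk); congr (dright _ _).
by apply/esym/eqP; rewrite -fd' fd.
Qed.

(** Atom [g] provides the neighbour stored in block [lift ord0 g], since block 0 describes the world
    itself. *)
Lemma renT u (g : 'I_4) f : T u -> decodes u f ->
  exists v, [/\ T v,
    num v Bt = (if g == ord_max then num u Bt else num u Bt'),
    num v Bk = num u (nth Bm [:: Bm; Bk; Bp; Bm] g),
    (g == ord_max -> forall i, i < D -> val v Pk i = val u Pm i) &
    forall f', decodes v f' -> f' (nbr 0) = f (lift ord0 g)].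
Proof.
move=> Tu fd; have [v Tv Hv] := @rensT g (ltn_ord g) u Tu; exists v.
set S := _.1 in Hv; set r := _.2 in Hv.
have BtS : Bt \in S by rewrite /S; case: (g) => -[|[|[|[|]]]] //= _; rewrite !inE.
have BkS : Bk \in S by rewrite /S; case: (g) => -[|[|[|[|]]]] //= _; rewrite !inE.
have fS h : inr (nbr 0, h) \in S.
  by rewrite /S; case: (g) => -[|[|[|[|]]]] //= _; rewrite !inE /= map_f ?mem_enum.
split=> //.
- transitivity (num u (r Bt)).
    by apply: eq_bigr => i _; rewrite -Hv.
  by rewrite /r; case: (g) => -[|[|[|[|]]]].
- transitivity (num u (r Bk)).
    by apply: eq_bigr => i _; rewrite -Hv.
  by rewrite /r; case: (g) => -[|[|[|[|]]]].
- move=> /eqP e i iD; rewrite -Hv//.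
    by rewrite /r e.
  by rewrite /S e /= !inE.
- move=> f' fd'; apply/eqP; rewrite -fd' -Hv//.
  have -> : r (inr (nbr 0, f (lift ord0 g))) = inr (lift ord0 g, f (lift ord0 g)).
    rewrite /r; set h := f _; clearbody h.
    case: g {BtS BkS fS Hv S r h} (h) => -[|[|[|[|]]]] //= ? h;
      by congr (inr (_, _)); apply: val_inj.
  by rewrite fd.
Qed.

(** Induction on [i] over all worlds of the team: the flag for i + 1 reduces to the flag for i at
    the neighbour (t, k-1). *)
Lemma positionT i u : T u -> i < D -> val u Pk i = (num u Bk == i).
Proof.
elim: i u => [|i IH] u Tu iD; have [_ fk _] := flagT Tu.
  have /and5P[_ _ _ /eqP + _] := okT Tu D0; rewrite !ffunE /= => ->.
  by rewrite fk.
have iD' := ltnW iD.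
have /and5P[_ _ _ _ /andP[/eqP + _]] := okT Tu iD'; rewrite !ffunE /= addn0 addn1 => ->.
rewrite fk.
have [f [fd _ _]] := ruleT Tu; have [v [Tv _ ek ep _]] := renT ord_max Tu fd.
rewrite -ep// IH// ek /=; have [_ -> _] := numT Tu.
by case: (num u Bk).
Qed.

Lemma rule_decodes u f : T u -> decodes u f ->
  rule (num u Bt == 0) (num u Bk == 0) ((num u Bk).+1 == K)
    (f (nbr 0)) (f (nbr 1)) (f (nbr 2)) (f (nbr 3)) (f (nbr 4)) /\
  forall i, i < D -> num u Bt = 0 -> num u Bk = i ->
    dright (f (nbr 0)) ord0 = rcell (ctape (conf x 0) ord0) i.
Proof.
move=> Tu fd; have [f' [fd' fr fi]] := ruleT Tu.
have e g : f' g = f g by apply/eqP; rewrite -fd' fd.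
rewrite -!e; split=> // i iD t0 ki; rewrite -fi ?positionT ?ki//.
Qed.

Lemma conf0_default k : size x <= k -> rcell (ctape (conf x 0) ord0) k = None.
Proof.
rewrite /conf /= ffunE eqxx; case: (x) => [|a y]; rewrite /rcell /=.
  by case: k => [|[]].
by case: k => //= k yk; rewrite nth_default ?size_map.
Qed.

(** The measure k + 2t drops at every neighbour used, even at (t-1, k+1), and none of them raises k
    + t; hence the bound [K] is preserved and no wrapped claim is consulted. *)
Lemma claimT t k u f : T u -> num u Bt = t -> num u Bk = k -> k + t < K ->
  decodes u f -> f (nbr 0) = claim x t k.
Proof.
have [n] := ubnP (k + t + t); elim: n t k u f => // n IH t k u f ltn Tu ut uk kt fd.
have nbrT (g : 'I_4) t' k' :
    (if g == ord_max then num u Bt else num u Bt') = t' ->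
    num u (nth Bm [:: Bm; Bk; Bp; Bm] g) = k' ->
    k' + t' + t' < n -> k' + t' < K -> f (lift ord0 g) = claim x t' k'.
  move=> et ek lt1 lt2; have [v [Tv vt vk _ Hv]] := renT g Tu fd.
  have [f' [fd' _ _]] := ruleT Tv.
  by rewrite -(Hv f')//; apply: IH fd'; rewrite // ?vt ?vk.
have [et em ep] := numT Tu.
have f4E : 0 < k -> f (nbr 4) = claim x t k.-1.
  move=> k0; have -> : nbr 4 = lift ord0 (ord_max : 'I_4) by apply: val_inj.
  apply: nbrT; rewrite ?eqxx//=; [|lia|lia].
  by rewrite em uk; case: (k) k0.
have [+ fi] := rule_decodes Tu fd; rewrite ut uk => /and3P[/eqP fz fs fr].
suff [e1 e2 e3] : [/\ dstate (f (nbr 0)) = cstate (conf x t),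
    dleft (f (nbr 0)) = dleft (claim x t k) & dright (f (nbr 0)) = dright (claim x t k)].
  suff e4 : dscan (f (nbr 0)) = dscan (claim x t k).
    exact: datum_eq.
  case: k uk fs f4E {ltn kt fz fi fr} e2 e3 => [|k] uk /= fs f4E e2 e3.
    by rewrite (eqP fs) e3; apply/ffunP => i; rewrite !ffunE.
  by case/andP: fs => _ /eqP ->; rewrite f4E.
case: t ltn ut kt fr f4E fi et nbrT => [|t] ltn ut kt /= fr f4E fi et nbrT.
  case/and5P: fr => _ /eqP -> /eqP -> /forallP fr fb; split=> //.
    by apply/ffunP => i; rewrite !ffunE /lcell; case: ifP => // _;
      case: (x) => [|? ?] /=; rewrite nth_nil.
  apply/ffunP => i; rewrite !ffunE /=.
  have [->|ni] := eqVneq i ord0; last first.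
    by have /implyP/(_ ni)/eqP -> := fr i; rewrite /rcell; case: (k) => [|[]].
  (* Offsets below [D] have a unary flag and are compared with the input. From [D] on, the cell at
     offset k - 1 already lies beyond the input, and its blankness passes on to offset k. *)
  have [kD|Dk] := ltnP k D; first by rewrite (fi k)//= ffunE.
  have -> : dright (f (nbr 0)) ord0 = None.
    apply/eqP; apply: (implyP fb).
    have k0 : 0 < k by apply: leq_trans Dk.
    rewrite -lt0n k0 f4E// /dright /= ffunE conf0_default//.
    by move: Dk; rewrite size_padded; case: (k) => // k' /=; lia.
  have := @conf0_default k; rewrite /= ffunE eqxx => ->//.
  by move: Dk; rewrite size_padded; lia.
(* As t is now positive, k + t < K keeps k away from K - 1, where the step is unchecked. *)
rewrite (_ : (k.+1 == K) = false) /= in fr; last by apply/eqP; lia.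
have f2E : f (nbr 2) = claim x t k.
  have -> : nbr 2 = lift ord0 (@Ordinal 4 1 isT) by apply: val_inj.
  by apply: nbrT => /=; [rewrite et ut | | lia | lia].
have f3E : f (nbr 3) = claim x t k.+1.
  have -> : nbr 3 = lift ord0 (@Ordinal 4 2 isT) by apply: val_inj.
  apply: nbrT => /=; [by rewrite et ut | | lia | lia].
  by rewrite ep uk /next; case: eqP => //; lia.
have f1E : 0 < k -> f (nbr 1) = claim x t k.-1.
  move=> k0; have -> : nbr 1 = lift ord0 (@Ordinal 4 0 isT) by apply: val_inj.
  apply: nbrT => /=; [by rewrite et ut | | lia | lia].
  by rewrite em uk; case: (k) k0.
move: fr; rewrite f2E f3E fz new_state_claim new_left_claim// new_right_claim//.
by move=> /and3P[/eqP -> /eqP -> /eqP ->].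
Qed.

(** Passing to (t-1, k) lowers t to 0; passing to (t, k-1) then lowers k and keeps t. *)
Lemma origin_in : (T !=set0)%classic -> exists u, [/\ T u, num u Bt = 0 & num u Bk = 0].
Proof.
case=> u0 Tu0; have [u Tu ut] : exists2 u, T u & num u Bt = 0.
  have [n] := ubnP (num u0 Bt); elim: n u0 Tu0 => // n IH u Tu un.
  case E: (num u Bt) => [|t]; first by exists u.
  have [f [fd _ _]] := ruleT Tu.
  have [v [Tv vt _ _ _]] := renT (@Ordinal 4 1 isT) Tu fd.
  apply: (IH v) => //; rewrite vt /=; have [-> _ _] := numT Tu.
  by move: un; rewrite E.
have [n] := ubnP (num u Bk); elim: n u Tu ut => // n IH u Tu ut un.
case E: (num u Bk) => [|k]; first by exists u.
have [f [fd _ _]] := ruleT Tu.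
have [v [Tv vt vk _ _]] := renT ord_max Tu fd.
apply: (IH v) => //; first by rewrite vt eqxx.
by rewrite vk /=; have [_ -> _] := numT Tu; move: un; rewrite E.
Qed.

(** The neighbour (t-1, k) of (0, 0) is (K-1, 0), just inside the range of [claimT], and [rule] at t
    = 0 makes its state accepting. *)
Lemma accepting_of_team : (T !=set0)%classic -> acc (cstate (conf x K.-1)).
Proof.
case/origin_in => u [Tu ut uk].
have [f [fd fr _]] := ruleT Tu.
have [v [Tv vt vk _ Hv]] := renT (@Ordinal 4 1 isT) Tu fd.
have [f' [fd' _ _]] := ruleT Tv.
have K0 : 0 < K by rewrite expn_gt0.
have e2 : f (nbr 2) = claim x K.-1 0.
  have -> : nbr 2 = lift ord0 (@Ordinal 4 1 isT) by apply: val_inj.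
  rewrite -(Hv f')//; apply: claimT Tv _ _ _ fd'.
  - by rewrite vt /=; have [-> _ _] := numT Tu; rewrite ut.
  - by rewrite vk.
  - by rewrite add0n prednK.
by move: fr; rewrite ut eqxx => /and3P[_ _ /and5P[+ _ _ _ _]]; rewrite e2.
Qed.

End Soundness.

(** * Completeness: the finite team of all true claims *)

Section Completeness.

Definition nbr_claim (g : 'I_5) (t k : nat) : datum :=
  claim x (nth t [:: t; prev K t; prev K t; prev K t; t] g)
    (nth k [:: k; prev K k; k; next K k; prev K k] g).

Definition model_val (w : 'I_K * 'I_K) (c : class) (i : nat) : bool :=
  let t := nat_of_ord w.1 in let k := nat_of_ord w.2 in
  match c with
  | inl g => nth false
      [:: bit i t; bit i (prev K t); bit i k; bit i (prev K k); bit i (next K k);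
          carry i (prev K t); carry i (prev K k); carry i k; k == i; prev K k == i;
          t == 0; k == 0; k.+1 == K] g
  | inr (g, h) => nbr_claim g t k == h
  end.

Lemma carry_top a : a < K -> carry D a = (a.+1 == K).
Proof.
move=> aK; apply/idP/eqP => [/dvdn_leq|e]; last by rewrite /carry e.
by move=> /(_ isT) Ka; apply/eqP; rewrite eqn_leq aK.
Qed.

Lemma adder_model w a x' y c flag i : i < D -> a < K ->
  (forall j, j < D -> model_val w x' j = bit j (next K a)) ->
  (forall j, model_val w y j = bit j a) ->
  (forall j, model_val w c j = carry j a) ->
  model_val w flag 0 = (a.+1 == K) ->
  adder_ok (nth None d i) [ffun b => model_val w b.1 (place i b.2)] x' y c flag.
Proof.
move=> iD aK ex ey ec ef; rewrite /adder_ok !ffunE /= addn0 addn1.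
rewrite ex// ey !ec ef carryS bit_next// !eqxx /= {1}/carry dvd1n /=.
apply/implyP; rewrite nth_padded_last// => /eqP e.
by rewrite -carryS e prednK ?carry_top// size_padded.
Qed.

Lemma rule_model t k : acc (cstate (conf x K.-1)) -> t < K -> k < K ->
  rule (t == 0) (k == 0) (k.+1 == K) (nbr_claim (nbr 0) t k) (nbr_claim (nbr 1) t k)
    (nbr_claim (nbr 2) t k) (nbr_claim (nbr 3) t k) (nbr_claim (nbr 4) t k).
Proof.
move=> accK tK kK; apply/and3P; split; first exact: eqxx.
  case: eqP => [k0|_].
    by apply/eqP/ffunP => i; rewrite !ffunE /= k0.
  by rewrite /nbr_claim /= !eqxx; apply/andP; split=> //; apply/eqP/ffunP => i; rewrite !ffunE.
case: t tK => [|t] tK /=.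
  apply/and5P; split; rewrite // ?eqxx//.
  - apply/eqP/ffunP => i; rewrite !ffunE /lcell /=; case: ifP => _ /=; last by rewrite nth_nil.
    by case: (x) => [|? ?] /=; rewrite nth_nil.
  - apply/forallP => i; apply/implyP => /negbTE i0; rewrite !ffunE /= i0 /rcell.
    by case: (k) => [|[]].
  - case: k kK => [|k] kK //=; apply/implyP; rewrite /dright /= !ffunE /= ?eqxx.
    case: (x) => [|a y]; rewrite /rcell /=; first by case: (k).
    case: k kK => [|k] //= kK; case: (ltnP k (size y)) => ky.
      by rewrite (nth_map a).
    by move=> _; rewrite nth_default// size_map ltnW.
(* At k = K - 1 no step is checked; otherwise k + 1 does not wrap around. *)
case: eqP => //= kK1; have kn : next K k = k.+1 by rewrite /next; case: eqP.
rewrite /nbr_claim /= kn new_state_claim new_left_claim ?new_right_claim//.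
- by rewrite !eqxx.
- by case: (k).
- by case: (k).
Qed.

Lemma sim_formula_complete : acc (cstate (conf x K.-1)) -> fin_satisfiable (sim_formula d).
Proof.
move=> accK; have K0 : 0 < K by rewrite expn_gt0.
have pK (a : 'I_K) : prev K a < K by rewrite prev_lt.
have nK (a : 'I_K) : next K a < K by rewrite next_lt.
apply: (@phi_fin_satisfiable _ _ sim_ok sim_rens None ('I_K * 'I_K)%type model_val).
- exact: (Ordinal K0, Ordinal K0).
- move=> [t k] _ i iD; apply/and5P; split; [| | | |apply/andP; split].
  + apply: (@adder_model _ (prev K t)) => //= [j jD|]; first by rewrite prevK.
    by rewrite prev_wrap.
  + apply: (@adder_model _ (prev K k)) => //= [j jD|]; first by rewrite prevK.
    by rewrite prev_wrap.
  + exact: (@adder_model _ k).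
  + by rewrite !ffunE.
  + by rewrite !ffunE /= addn0 addn1; case: (nat_of_ord k).
  + apply/existsP; exists [ffun g => nbr_claim g t k]; apply/and3P; split.
    * by apply/forallP => g; apply/forallP => h; rewrite !ffunE.
    * rewrite ![[ffun _ => nbr_claim _ _ _] _]ffunE ![[ffun _ => model_val _ _ _] _]ffunE.
      exact: rule_model.
    * rewrite ![[ffun _ => nbr_claim _ _ _] _]ffunE ![[ffun _ => model_val _ _ _] _]ffunE /=.
      apply/implyP; rewrite addn0 => /andP[/eqP t0 /eqP ki].
      by rewrite input_padded /dright /= t0 ki ffunE.
- move=> [|[|[|[|]]]] //= _ [t k] _.
  + exists (Ordinal (pK t), Ordinal (pK k)) => // c i + iD.
    by rewrite !inE => /or3P[/eqP ->|/eqP ->|/mapP[h _ ->]].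
  + exists (Ordinal (pK t), k) => // c i + iD.
    by rewrite !inE => /or3P[/eqP ->|/eqP ->|/mapP[h _ ->]].
  + exists (Ordinal (pK t), Ordinal (nK k)) => // c i + iD.
    by rewrite !inE => /or3P[/eqP ->|/eqP ->|/mapP[h _ ->]].
  + exists (t, Ordinal (pK k)) => // c i + iD.
    by rewrite !inE => /or4P[/eqP ->|/eqP ->|/eqP ->|/mapP[h _ ->]].
Qed.

End Completeness.

Lemma sim_formula_sound : satisfiable (sim_formula d) -> acc (cstate (conf x K.-1)).
Proof.
by case=> N [T [T0 /holds_phi[dT rT]]]; exact: (accepting_of_team dT rT T0).
Qed.

End Correctness.
End Simulation.

(** * Computing the reduction *)

Section Templates.
Variable letter : Type.

(* [Some h] is the token [h s], where s is the current letter; [None] stands for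
   the current index i, written in unary as i + 1 bits. *)
Definition elem : Type := option (letter -> token).

Definition expand (i : nat) (s : letter) (tm : seq elem) : seq token :=
  flatten [seq if e is Some h then [:: h s] else nseq i.+1 (TBit true) | e : elem <- tm].

Inductive segment := Const of seq token | Loop of seq elem.

Definition segment_text (l0 : letter) (d : seq letter) (g : segment) : seq token :=
  match g with
  | Const ts => ts
  | Loop tm => flatten [seq expand i (nth l0 d i) tm | i <- iota 0 (size d)]
  end.

Definition text l0 d (gs : seq segment) : seq token :=
  flatten [seq segment_text l0 d g | g <- gs].

End Templates.

(** * A program that writes such a text *)

Section Emission.
Variables (A : finType) (k : nat).

Notation letter := (option (option A)).
(** [None] is the left end marker [hash]; [Some (l, b)] is a cell with letter [l], marked if [b]. *)
Definition mark_sym : Type := option (letter * bool).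
Notation S := (option (A + token + mark_sym)).
Notation tapes := {ffun 'I_k.+3 -> tape S}.
Notation vec := {ffun 'I_k.+3 -> S}.
Notation prog := (prog k.+2 A token mark_sym).

Definition hash : S := Some (inr None).
Definition cell (l : letter) : S := Some (inr (Some (l, false))).
Definition marked_cell (l : letter) : S := Some (inr (Some (l, true))).
Definition cell_letter (s : S) : letter :=
  if s is Some (inr (Some (l, _))) then l else None.
Definition is_marked (s : S) : bool :=
  if s is Some (inr (Some (_, b))) then b else false.
Definition out_sym (t : token) : S := Some (inl (inr t)).

(** Tape 0 holds the input, tapes 1 to k are counters, tape k + 1 holds the padded word, and the
    last tape holds the output. *)
Definition data_tape : 'I_k.+3 := inord k.+1.
Definition out_tape : 'I_k.+3 := ord_max.

Lemma data_neq_out : data_tape != out_tape.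
Proof. by rewrite -val_eqE /= inordK// ltn_eqF. Qed.

Definition setup (t : tapes) (d o : tape S) : tapes := upd (upd t data_tape d) out_tape o.

Lemma setup_data t d o : setup t d o data_tape = d.
Proof. by rewrite /setup updN ?data_neq_out// updE. Qed.

Lemma upd_setup t d o d' : upd (setup t d o) data_tape d' = setup t d' o.
Proof. by rewrite /setup updC ?updK// eq_sym data_neq_out. Qed.

Definition written (y : seq token) : tape S := zip_tape [::] [seq out_sym b | b <- y] [::].

Definition emit (h : letter -> token) : prog :=
  pact (fun v : vec =>
    [ffun j => if j == out_tape then (out_sym (h (cell_letter (v data_tape))), Right)
               else (v j, Stay)]).

Lemma exec_emit h t d y : exec (emit h) (setup t d (written y))
  (setup t d (written (rcons y (h (cell_letter (scanned d)))))).
Proof.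
have := exec_act (fun v : vec =>
    [ffun j => if j == out_tape then (out_sym (h (cell_letter (v data_tape))), Right)
               else (v j, Stay)]) (setup t d (written y)).
congr exec_from; apply/ffunP => j; rewrite !ffunE.
rewrite /= (negbTE data_neq_out) eqxx.
case: eqP => [_|_]; last by case: (if _ then _ else _).
by rewrite zip_right /written map_rcons.
Qed.

(* The current cell is marked, so that the head finds it again after having
   walked to the left end to count its index. *)
Definition emit_index : prog :=
  pseq (on data_tape (fun s => (marked_cell (cell_letter s), Stay)))
    (pseq (pwhile (fun v : vec => v data_tape != hash)
             (pseq (emit (fun _ => TBit true)) (on data_tape (keep Left))))
    (pseq (pwhile (fun v : vec => ~~ is_marked (v data_tape)) (on data_tape (keep Right)))
      (on data_tape (fun s => (cell (cell_letter s), Stay))))).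

Lemma exec_on_data h t d o :
  exec (on data_tape h) (setup t d o) (setup t (act d (h (scanned d))) o).
Proof. by have := exec_on h (setup_data t d o); rewrite upd_setup. Qed.

(** The current cell is counted too, which yields the i + 1 bits of index i in [name]. *)
Lemma exec_unary t p q y : hash \notin head None q :: p ->
  exec (pwhile (fun v : vec => v data_tape != hash)
          (pseq (emit (fun _ => TBit true)) (on data_tape (keep Left))))
    (setup t (zip_tape [:: hash] p q) (written y))
    (setup t (zip_tape [::] [::] (hash :: p ++ head None q :: behead q))
       (written (y ++ nseq (size p).+1 (TBit true)))).
Proof.
elim/last_ind: p q y => [|p s IH] q y hp.
  apply: exec_while.
  - by rewrite ffunE setup_data; move: hp; rewrite inE eq_sym.
  - exact: exec_seq (exec_emit _ _ _ _) (exec_on_data _ _ _ _).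
  - rewrite cats1; apply: exec_while_done.
    by rewrite ffunE setup_data eqxx.
apply: exec_while.
- by rewrite ffunE setup_data; move: hp; rewrite inE eq_sym negb_or => /andP[].
- exact: exec_seq (exec_emit _ _ _ _) (exec_on_data _ _ _ _).
rewrite /keep zip_left size_rcons -[nseq (size p).+2 _]/([:: _] ++ nseq (size p).+1 _).
rewrite catA cats1 cat_rcons.
apply: (IH (s :: head None q :: behead q)).
by move: hp; rewrite !inE mem_rcons inE /= !negb_or => /and3P[_ -> ->].
Qed.

Lemma exec_emit_index t p l q y :
  hash \notin p -> ~~ has is_marked p ->
  exec emit_index (setup t (zip_tape [:: hash] p (cell l :: q)) (written y))
    (setup t (zip_tape [:: hash] p (cell l :: q))
       (written (y ++ nseq (size p).+1 (TBit true)))).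
Proof.
move=> hp mp; apply: exec_seq; first exact: exec_on_data.
rewrite zip_stay; apply: exec_seq; first by apply: exec_unary; rewrite inE.
rewrite /=; set o := written _; set q' := marked_cell l :: q.
have e : setup t (zip_tape [::] [::] (hash :: p ++ q')) o data_tape =
    zip_tape [::] [::] ((hash :: p) ++ q').
  by rewrite setup_data.
apply: exec_seq.
  apply: (@exec_right_to _ _ _ _ _ (fun y => ~~ is_marked y)) e _ => //=.
  by apply/allP => z zp; apply: contra mp => mz; apply/hasP; exists z.
rewrite upd_setup.
have -> : zip_tape [::] ([::] ++ hash :: p) q' = zip_tape [:: hash] p q'.
  by rewrite /zip_tape /= rev_cons -cats1 cats0.
exact: exec_on_data.
Qed.

Definition emit_elem (e : elem letter) : prog :=
  if e is Some h then emit h else emit_index.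

Definition pseqs (l : seq prog) : prog := foldr (@pseq _ _ _ _) (pskip _ _ _ _) l.

Lemma cells_clean (d : seq letter) :
  (hash \notin map cell d) && ~~ has is_marked (map cell d).
Proof. by elim: d => //= l d; rewrite inE. Qed.

Lemma exec_template t d l q y tm :
  exec (pseqs (map emit_elem tm))
    (setup t (zip_tape [:: hash] (map cell d) (cell l :: q)) (written y))
    (setup t (zip_tape [:: hash] (map cell d) (cell l :: q)) (written (y ++ expand (size d) l tm))).
Proof.
elim: tm y => [|e tm IH] y; first by rewrite cats0; exact: exec_skip.
rewrite [expand _ _ _]/(_ ++ expand (size d) l tm) catA; apply: exec_seq (IH _).
case: e => [h|] /=; first by rewrite cats1; exact: exec_emit.
have /andP[h1 h2] := cells_clean d.
by have := exec_emit_index t l q y h1 h2; rewrite size_map.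
Qed.

Definition emit_segment (g : segment letter) : prog :=
  match g with
  | Const ts => pseqs [seq emit (fun _ => t) | t <- ts]
  | Loop tm => pseq (pwhile (fun v : vec => v data_tape != None)
                       (pseq (pseqs (map emit_elem tm)) (on data_tape (keep Right))))
                 (rewind data_tape hash)
  end.

Definition ready (d : seq letter) : tape S :=
  zip_tape [:: hash] [::] (map cell d ++ [:: None]).

(** Generalised to a processed prefix [d1], whose length is the index of the current cell. *)
Lemma exec_loop t d1 d2 y l0 tm :
  exec (pwhile (fun v : vec => v data_tape != None)
          (pseq (pseqs (map emit_elem tm)) (on data_tape (keep Right))))
    (setup t (zip_tape [:: hash] (map cell d1) (map cell d2 ++ [:: None])) (written y))
    (setup t (zip_tape [:: hash] (map cell (d1 ++ d2)) [:: None])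
      (written (y ++ flatten [seq expand (size d1 + i) (nth l0 d2 i) tm | i <- iota 0 (size d2)]))).
Proof.
elim: d2 d1 y => [|l d2 IH] d1 y /=.
  by rewrite !cats0; apply: exec_while_done; rewrite ffunE setup_data.
apply: exec_while; first by rewrite ffunE setup_data.
  exact: exec_seq (exec_template _ _ _ _ _ _) (exec_on_data _ _ _ _).
rewrite /keep zip_right -map_rcons.
have := IH (rcons d1 l) (y ++ expand (size d1) l tm).
rewrite -catA cat_rcons size_rcons addn0 (iotaDl 1 0) -map_comp.
congr (exec_from _ _ (setup _ _ (written (_ ++ (_ ++ flatten _))))).
by apply: eq_map => i /=; rewrite addSn addnS.
Qed.

Lemma exec_segment t d y g :
  exec (emit_segment g) (setup t (ready d) (written y))
    (setup t (ready d) (written (y ++ segment_text None d g))).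
Proof.
case: g => [ts|tm] /=.
  elim: ts y => [|s ts IH] y; first by rewrite cats0; exact: exec_skip.
  by rewrite -cat_rcons; apply: exec_seq (IH _); exact: exec_emit.
apply: exec_seq; first exact: (@exec_loop t [::] d y None).
have /andP[h _] := cells_clean d.
have := @exec_rewind _ _ _ _ data_tape hash _ _ _ _ (setup_data _ _ _) _.
move=> /(_ t (map cell d) None [::] (written (y ++ segment_text None d (Loop tm)))).
by rewrite inE /= h upd_setup => /(_ isT).
Qed.

Lemma exec_segments t d y gs :
  exec (pseqs (map emit_segment gs)) (setup t (ready d) (written y))
    (setup t (ready d) (written (y ++ text None d gs))).
Proof.
elim: gs y => [|g gs IH] y; first by rewrite cats0; exact: exec_skip.
by rewrite [text _ _ _]/(_ ++ text None d gs) catA; apply: exec_seq (IH _); exact: exec_segment.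
Qed.

End Emission.

Lemma leq_expn_base m n e : m <= n -> m ^ e <= n ^ e.
Proof. by case: e => // e mn; rewrite leq_exp2r. Qed.

(** * Preparing the padded word, and the space bound *)

Section Reduction.
Variables (A : finType) (k : nat).
Hypothesis k0 : 0 < k.

Notation letter := (option (option A)).
Notation S := (option (A + token + mark_sym A)).
Notation tapes := {ffun 'I_k.+3 -> tape S}.
Notation vec := {ffun 'I_k.+3 -> S}.
Notation prog := (prog k.+2 A token (mark_sym A)).
Notation data := (data_tape k).
Notation out := (out_tape k).
Notation hash := (hash A).

Definition counter (j : nat) : 'I_k.+3 := inord j.+1.

Lemma counter_neq j : j < k ->
  [/\ (counter j == ord0) = false, (counter j == data) = false &
      (counter j == out) = false].
Proof.
by move=> jk; rewrite -!val_eqE /= !inordK; try lia; split; apply/eqP; lia.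
Qed.

Lemma counter_eq i j : i < k -> j < k -> (counter i == counter j) = (i == j).
Proof. by move=> ik jk; rewrite -val_eqE /= !inordK; lia. Qed.

Definition layout (I C D O : tape S) : tapes :=
  [ffun i => if i == ord0 then I else if i == out then O
             else if i == data then D else C].

(* All counters are in the same state and move together. *)
Definition joint (fi fc : S -> S * move) (fd : S -> S -> S * move) : prog :=
  pact (fun v : vec =>
    [ffun i => if i == ord0 then fi (v ord0) else if i == out then (v i, Stay)
               else if i == data then fd (v ord0) (v data) else fc (v (counter 0))]).

Lemma data_neq0 : (data == ord0) = false.
Proof. by rewrite -val_eqE /= inordK. Qed.

Lemma out_neq0 : (out == ord0) = false.
Proof. by []. Qed.

Lemma scans_layout I C D O :
  [/\ scans (layout I C D O) ord0 = scanned I,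
      scans (layout I C D O) (counter 0) = scanned C &
      scans (layout I C D O) data = scanned D].
Proof.
have [c0 cd co] := counter_neq k0.
by rewrite !ffunE eqxx c0 cd co data_neq0 (negbTE (data_neq_out _)) eqxx.
Qed.

Lemma exec_joint fi fc fd I C D O : exec (joint fi fc fd) (layout I C D O)
  (layout (act I (fi (scanned I))) (act C (fc (scanned C)))
     (act D (fd (scanned I) (scanned D))) O).
Proof.
have [sI sC sD] := scans_layout I C D O.
have := exec_act (fun v : vec =>
    [ffun i => if i == ord0 then fi (v ord0) else if i == out then (v i, Stay)
               else if i == data then fd (v ord0) (v data) else fc (v (counter 0))])
  (layout I C D O).
rewrite sI sC sD; congr exec_from; apply/ffunP => i; rewrite !ffunE.
case: (i == ord0) => //; case: (i == out); first by case: (O).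
by case: (i == data).
Qed.

Lemma act_keep (t : tape S) : act t (keep Stay (scanned t)) = t.
Proof. by case: t. Qed.

Definition pad_cell : S := cell (Some None).
Definition input_cell (s : S) : S :=
  cell (if s is Some (inl (inl a)) then Some (Some a) else None).

Definition copy_input : prog :=
  pwhile (fun v : vec => v ord0 != None)
    (joint (keep Right) (fun _ => (pad_cell, Right)) (fun i _ => (input_cell i, Right))).

Definition in_sym (a : A) : S := Some (inl (inl a)).

Lemma exec_copy_input p r O :
  exec copy_input
    (layout (zip_tape [::] (map in_sym p) (map in_sym r))
       (zip_tape [:: hash] (nseq (size p) pad_cell) [::])
       (zip_tape [:: hash] [seq cell (Some (Some a)) | a <- p] [::]) O)
    (layout (zip_tape [::] (map in_sym (p ++ r)) [::])
       (zip_tape [:: hash] (nseq (size (p ++ r)) pad_cell) [::])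
       (zip_tape [:: hash] [seq cell (Some (Some a)) | a <- p ++ r] [::]) O).
Proof.
elim: r p => [|a r IH] p.
  rewrite cats0; apply: exec_while_done.
  by have [-> _ _] := scans_layout (zip_tape [::] (map in_sym p) (map in_sym [::]))
     (zip_tape [:: hash] (nseq (size p) pad_cell) [::])
     (zip_tape [:: hash] [seq cell (Some (Some a)) | a <- p] [::]) O.
apply: exec_while; last by rewrite -cat_rcons; exact: IH.
  by rewrite !ffunE eqxx.
have := exec_joint (keep Right) (fun _ => (pad_cell, Right)) (fun i _ => (input_cell i, Right))
  (zip_tape [::] (map in_sym p) (map in_sym (a :: r)))
       (zip_tape [:: hash] (nseq (size p) pad_cell) [::])
       (zip_tape [:: hash] [seq cell (Some (Some a)) | a <- p] [::]) O.
rewrite /keep !zip_right.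
rewrite size_rcons !map_rcons -!cats1.
by rewrite -[[:: pad_cell]]/(nseq 1 pad_cell) -nseqD addn1.
Qed.

(** The counters still move together, so the test looks at the first one for all. *)
Definition rewind_counters : prog :=
  pseq (pwhile (fun v : vec => v (counter 0) != hash)
          (joint (keep Stay) (keep Left) (fun _ => keep Stay)))
    (joint (keep Stay) (keep Right) (fun _ => keep Stay)).

Lemma exec_rewind_counters I p q D O : hash \notin head None q :: p ->
  exec rewind_counters (layout I (zip_tape [:: hash] p q) D O)
    (layout I (zip_tape [:: hash] [::] (p ++ head None q :: behead q)) D O).
Proof.
move=> hp; apply: (@exec_seq _ _ _ _ _ _ _
   (layout I (zip_tape [::] [::] (hash :: p ++ head None q :: behead q)) D O)); last first.
  have := exec_joint (keep Stay) (keep Right) (fun _ => keep Stay)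
    I (zip_tape [::] [::] (hash :: p ++ head None q :: behead q)) D O.
  by rewrite !act_keep /keep zip_right.
elim/last_ind: p q hp => [|p y IH] q hp.
  apply: exec_while.
  - have [_ -> _] := scans_layout I (zip_tape [:: hash] [::] q) D O.
    by move: hp; rewrite inE eq_sym.
  - exact: exec_joint.
  rewrite !act_keep.
  apply: exec_while_done.
  have [_ -> _] := scans_layout I (zip_tape [::] [::] [:: hash, head None q & behead q]) D O.
  by rewrite eqxx.
apply: exec_while.
- have [_ -> _] := scans_layout I (zip_tape [:: hash] (rcons p y) q) D O.
  by move: hp; rewrite inE eq_sym negb_or => /andP[].
- exact: exec_joint.
rewrite !act_keep /keep zip_left cat_rcons.
apply: (IH (y :: head None q :: behead q)).
by move: hp; rewrite !inE mem_rcons inE /= !negb_or => /and3P[_ -> ->].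
Qed.

(** Nested loops over [j] counters of length n append n ^ j pads. Each loop rewinds its counter, so
    that the enclosing loop can run it again. *)
Fixpoint multiply (j : nat) : prog :=
  if j is i.+1 then
    pseq (pwhile (fun v : vec => v (counter i) != None)
            (pseq (multiply i) (on (counter i) (keep Right))))
      (rewind (counter i) hash)
  else on data (fun _ => (pad_cell, Right)).

Definition full_counter (n : nat) : tape S :=
  zip_tape [:: hash] [::] (nseq n pad_cell ++ [:: None]).

Lemma exec_multiply n j (t : tapes) w : j <= k ->
  (forall i, i < j -> t (counter i) = full_counter n) ->
  t data = zip_tape [:: hash] w [::] ->
  exec (multiply j) t
    (upd t data (zip_tape [:: hash] (w ++ nseq (n ^ j) pad_cell) [::])).
Proof.
elim: j t w => [|j IH] t w jk tC tD.
  by have := exec_on (fun _ => (pad_cell, Right)) tD; rewrite zip_right -cats1.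
have [_ cd _] := counter_neq jk.
(* The loop at level [j], with [a] cells of its counter passed and [b] cells left. *)
have loop a b (t' : tapes) w' :
    (forall i, i < j -> t' (counter i) = full_counter n) ->
    t' (counter j) = zip_tape [:: hash] (nseq a pad_cell) (nseq b pad_cell ++ [:: None]) ->
    t' data = zip_tape [:: hash] w' [::] ->
    exec (pwhile (fun v : vec => v (counter j) != None)
            (pseq (multiply j) (on (counter j) (keep Right)))) t'
      (upd (upd t' data (zip_tape [:: hash] (w' ++ nseq (b * n ^ j) pad_cell) [::]))
        (counter j) (zip_tape [:: hash] (nseq (a + b) pad_cell) [:: None])).
  elim: b a t' w' => [|b IHb] a t' w' t'C t'j t'D.
    rewrite cats0 addn0 (upd_id t'D) (upd_id t'j).
    by apply: exec_while_done; rewrite ffunE t'j.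
  apply: exec_while; first by rewrite ffunE t'j.
    apply: exec_seq; first exact: (IH t' w' (ltnW jk) t'C t'D).
    by apply: exec_on; rewrite updN; [exact: t'j | rewrite cd].
  rewrite /keep zip_right.
  set t1 := upd (upd _ _ _) _ _.
  have t1C i : i < j -> t1 (counter i) = full_counter n.
    move=> ij; have ik : i < k by lia.
    have [_ cd' _] := counter_neq ik.
    have ne : counter i != counter j by rewrite counter_eq// ltn_eqF.
    by rewrite updN// updN ?cd'//; exact: t'C.
  have t1D : t1 data = zip_tape [:: hash] (w' ++ nseq (n ^ j) pad_cell) [::].
    by rewrite updN 1?eq_sym ?cd// updE.
  have nS a' : rcons (nseq a' pad_cell) pad_cell = nseq a'.+1 pad_cell.
    by rewrite -cats1 -[[:: _]]/(nseq 1 pad_cell) -nseqD addn1.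
  have := IHb a.+1 t1 (w' ++ nseq (n ^ j) pad_cell) t1C _ t1D.
  rewrite updE /= nS => /(_ erefl).
  rewrite -catA -nseqD -mulSn addnS.
  congr exec_from; apply/ffunP => i; rewrite !ffunE.
  by case: (i == counter j) => //; case: (i == data).
have tj := tC j (ltnSn j).
have tC' i (ij : i < j) := tC i (ltnW ij).
apply: exec_seq; first exact: (loop 0 n t w tC' tj tD).
rewrite add0n -expnS.
set t1 := upd (upd _ _ _) _ _.
have t1j : t1 (counter j) = zip_tape [:: hash] (nseq n pad_cell) [:: None] by rewrite updE.
have := exec_rewind t1j; rewrite inE mem_nseq andbF => /(_ isT).
by rewrite updK -/(full_counter n) upd_id// updN ?cd.
Qed.

(** Two pads beyond the copied length make the counters |x| + 2 long, so the base of the power is at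
    least 2 even for the empty input. The closing [cell None] is the distinguished last letter. *)
Definition prepare : prog :=
  pseqs [:: joint (keep Stay) (fun _ => (hash, Right)) (fun _ _ => (hash, Right));
    copy_input;
    joint (keep Stay) (fun _ => (pad_cell, Right)) (fun _ => keep Stay);
    joint (keep Stay) (fun _ => (pad_cell, Right)) (fun _ => keep Stay);
    rewind_counters;
    multiply k;
    on data (fun _ => (cell None, Right));
    rewind data hash].

Definition word (x : seq A) : seq letter := padded x ((size x + 2) ^ k).

Definition layout_done (x : seq A) (y : seq token) : tapes :=
  layout (zip_tape [::] (map in_sym x) [::]) (full_counter (size x + 2))
    (ready (word x)) (written A y).


Lemma layout_setup I C D O d o : setup (layout I C D O) d o = layout I C d o.
Proof.
apply/ffunP => i; rewrite !ffunE.
case: eqP => [->|_]; first by rewrite out_neq0.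
by case: eqP => [->|_] //; rewrite data_neq0.
Qed.

Lemma upd_data_layout I C D O d : upd (layout I C D O) data d = layout I C d O.
Proof.
apply/ffunP => i; rewrite !ffunE.
by case: eqP => [->|_] //; rewrite data_neq0 (negbTE (data_neq_out _)).
Qed.

Lemma layout_data I C D O : layout I C D O data = D.
Proof. by rewrite ffunE data_neq0 (negbTE (data_neq_out _)) eqxx. Qed.

Lemma layout_counter I C D O i : i < k -> layout I C D O (counter i) = C.
Proof. by move=> /counter_neq[e1 e2 e3]; rewrite ffunE e1 e2 e3. Qed.

Lemma exec_prepare x :
  exec prepare
    (layout (zip_tape [::] [::] (map in_sym x)) (zip_tape [::] [::] [::])
       (zip_tape [::] [::] [::]) (written A [::]))
    (layout_done x [::]).
Proof.
set I := zip_tape [::] (map in_sym x) [::].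
set n := size x + 2.
set dx := [seq cell (Some (Some a)) | a <- x] : seq S.
have hdx : hash \notin dx by apply/mapP => -[].
apply: exec_seq; first exact: exec_joint.
rewrite act_keep !zip_right.
apply: exec_seq; first exact: (exec_copy_input [::] x).
rewrite /= -/I -/dx.
apply: exec_seq; first exact: exec_joint.
rewrite !act_keep zip_right.
apply: exec_seq; first exact: exec_joint.
rewrite !act_keep zip_right.
have -> : rcons (rcons (nseq (size x) pad_cell) pad_cell) pad_cell = nseq n pad_cell.
  by rewrite -!cats1 -catA /n nseqD.
apply: exec_seq; first by apply: exec_rewind_counters; rewrite inE mem_nseq andbF.
apply: exec_seq.
  apply: (@exec_multiply n k _ dx) => //; last by rewrite layout_data.
  by move=> i ik; rewrite layout_counter.
rewrite upd_data_layout.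
apply: exec_seq; first by apply: exec_on; rewrite layout_data.
rewrite upd_data_layout zip_right zip_blank.
have -> : rcons (dx ++ nseq (n ^ k) pad_cell) (cell None) = map (@cell A) (word x).
  by rewrite /word /padded !map_cat map_nseq -map_comp -cats1 catA.
set L := layout _ _ _ _.
have LD : L data = zip_tape [:: hash] (map (@cell A) (word x)) [:: None] by rewrite layout_data.
have /andP[hw _] := cells_clean (word x).
have := exec_rewind LD; rewrite inE hw => /(_ isT); rewrite upd_data_layout => e.
exact: exec_seq e (exec_skip _).
Qed.

Variable gs : seq (segment letter).

Definition reducer : prog := pseq prepare (pseqs (map (@emit_segment A k) gs)).

Lemma exec_reducer x :
  exec reducer (ctape (init (to_machine reducer) x)) (layout_done x (text None (word x) gs)).
Proof.
have -> : ctape (init (to_machine reducer) x) =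
    layout (zip_tape [::] [::] (map in_sym x)) (zip_tape [::] [::] [::])
       (zip_tape [::] [::] [::]) (written A [::]).
  apply/ffunP => i; rewrite !ffunE; case: (i == ord0).
    by rewrite /= -/in_sym; case: (map in_sym x).
  by case: ifP => //; case: ifP.
apply: exec_seq; first exact: exec_prepare.
have := exec_segments (layout_done x [::]) (word x) [::] gs.
by rewrite !layout_setup.
Qed.

Lemma outputs_written (M : machine A token) y (c : config M) :
  ctape c ord_max = zip_tape [::] [seq Some (inl (inr b)) | b <- y] [::] ->
  outputs c y.
Proof. by move=> e; exists 0, 1; rewrite e /contents /zip_tape /= cats0 revK. Qed.

Lemma tape_size_zip X (b p q : seq (option X)) :
  tape_size (zip_tape b p q) <= size b + size p + (size q).+1.
Proof. by rewrite /tape_size /= size_cat size_rev size_behead; lia. Qed.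

Lemma size_expand i (s : letter) tm : size (expand i s tm) <= size tm * i.+1.
Proof.
elim: tm => //= e tm IH; rewrite /expand /= size_cat mulSn leq_add//.
by case: e => //=; rewrite size_nseq.
Qed.

Definition segment_size (g : segment letter) : nat :=
  match g with Const ts => size ts | Loop tm => size tm end.

(** A loop writes [size d] copies of its template, and every index in them takes at most [size d]
    bits. *)
Lemma size_segment_text d g : size (segment_text None d g) <= segment_size g * (size d).+1 ^ 2.
Proof.
case: g => [ts|tm] /=; first by rewrite leq_pmulr// expn_gt0.
rewrite size_flatten /shape -map_comp sumnE big_map.
apply: leq_trans (_ : \sum_(i <- iota 0 (size d)) size tm * (size d).+1 <= _).
  rewrite big_seq [X in _ <= X]big_seq; apply: leq_sum => i; rewrite mem_iota => id.
  by apply: leq_trans (size_expand _ _ _) _; rewrite leq_mul2l; lia.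
by rewrite big_const_seq count_predT size_iota iter_addn_0; nia.
Qed.

Lemma size_text d : size (text None d gs) <= sumn (map segment_size gs) * (size d).+1 ^ 2.
Proof.
rewrite /text; elim: gs => //= g l IH.
by rewrite size_cat mulnDl leq_add// size_segment_text.
Qed.

Lemma poly_bound_exp a e : exists c, forall n, a * (n + 2) ^ e <= poly_bound c n.
Proof.
(* For n >= 2 the power suffices, by a <= n ^ a and n + 2 <= n ^ 2; for n <= 1 the additive term
   covers a * 3 ^ e. *)
exists (a + 2 * e + a * 3 ^ e) => n; rewrite /poly_bound.
have [n1|n1] := leqP n 1.
  apply: leq_trans (_ : a * 3 ^ e <= _); last lia.
  by rewrite leq_mul2l leq_expn_base ?orbT//; lia.
apply: leq_trans (leq_addr _ _).
apply: leq_trans (_ : n ^ (a + 2 * e) <= _); last by rewrite leq_pexp2l//; lia.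
rewrite expnD expnM; apply: leq_mul.
  by apply: leq_trans (ltnW (ltn_expl a (isT : 1 < 2))) _; exact: leq_expn_base.
by apply: leq_expn_base; rewrite expnS expn1; nia.
Qed.

Lemma PSPACE_text : PSPACE_computable (fun x => text None (word x) gs).
Proof.
pose s := sumn (map segment_size gs).
(* For a word of length d there are k + 3 tapes of at most (s + 6)(d + 1)^2 cells each, and (d +
   1)^2 <= 4 (|x| + 2)^(2(k + 1)). *)
have [c cP] := poly_bound_exp ((s + 6) * k.+3 * 4) (2 * k.+1).
exists (to_machine reducer), c => x.
have [n [f [rn hf ef]]] := exec_run (exec_reducer x).
have rn' : run n (init (to_machine reducer) x) = f by [].
have bound : space f <= poly_bound c (size x).
  apply: leq_trans (cP _); set d := size (word x).
  have d4 : d.+1 <= 2 * (size x + 2) ^ k.+1.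
    rewrite /d /word size_padded expnS.
    have : 0 < (size x + 2) ^ k by rewrite expn_gt0 addn2.
    nia.
  apply: leq_trans (_ : \sum_(i < k.+3) (s + 6) * d.+1 ^ 2 <= _).
    have txt := size_text (word x); rewrite -/d -/s in txt.
    have dx : size x + 2 <= d.+1 by rewrite /d /word size_padded; lia.
    apply: leq_sum => i _; rewrite ef ffunE.
    case: ifP => _; last case: ifP => _; last case: ifP => _;
      apply: leq_trans (tape_size_zip _ _ _) _; rewrite ?size_cat ?size_map ?size_nseq /= -?/d; nia.
  rewrite sum_nat_const card_ord.
  have -> : 2 * k.+1 = k.+1 * 2 by lia.
  rewrite expnM; have : d.+1 ^ 2 <= 4 * ((size x + 2) ^ k.+1) ^ 2.
    by have := leq_expn_base 2 d4; rewrite expnMn.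
  nia.
split=> [|t].
  exists n; rewrite rn'; split=> //; apply: outputs_written.
  by rewrite ef /layout_done ffunE /= /out_tape eqxx.
have [tn|nt] := leqP t n.
  by apply: leq_trans (space_run _ tn) _; rewrite rn'.
by rewrite -(subnKC (ltnW nt)) run_halted rn'.
Qed.

End Reduction.

(** * Hardness *)

Section FormulaText.
Variables (C letter : finType).
Implicit Types (i : nat) (s : letter).

Notation elem := (elem letter).
Definition tok (t : token) : elem := Some (fun _ => t).

(** The index element gives i + 1 bits, and [e] adds one more for place i + 1; place 0 is a single
    bit. *)
Definition name_template (c : C) (k : option bool) : seq elem :=
  tok TVar :: [seq tok (TBit (c == b)) | b <- enum C] ++
  (if k is Some e then None :: nseq e (tok (TBit true)) else [:: tok (TBit true)]).

Fixpoint template (g : sform C letter) : seq elem :=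
  match g with
  | SLit b c k => if b then name_template c k else tok TNeg :: name_template c k
  | STest P => [:: Some (fun s => if P s then TOr else TAnd); tok TVar; tok TNeg; tok TVar]
  | SAnd g h => tok TAnd :: template g ++ template h
  | SOr g h => tok TOr :: template g ++ template h
  end.

Lemma expand_cat i s (t1 t2 : seq elem) :
  expand i s (t1 ++ t2) = expand i s t1 ++ expand i s t2.
Proof. by rewrite /expand map_cat flatten_cat. Qed.

Lemma expand_cons i s (e : elem) t : expand i s (e :: t) =
  (if e is Some h then [:: h s] else nseq i.+1 (TBit true)) ++ expand i s t.
Proof. by []. Qed.

Lemma expand_toks i s (T : Type) (h : T -> token) l :
  expand i s [seq tok (h x) | x <- l] = map h l.
Proof. by elim: l => //= x l <-. Qed.

Lemma expand_name i s c k :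
  expand i s (name_template c k) = write_psym (name c (place i k)).
Proof.
rewrite /name_template expand_cons expand_cat expand_toks /write_psym /name.
rewrite map_cat -map_comp map_nseq.
congr (_ :: _ ++ _); case: k => [e|] //.
by rewrite expand_cons [place _ _]/= -addSn nseqD; case: e.
Qed.

Lemma expand_template i s g : expand i s (template g) = write (inst i s g).
Proof.
elim: g => [b c k|P|g IHg h IHh|g IHg h IHh] /=.
- by case: b; [exact: expand_name | exact: (congr1 (cons TNeg) (expand_name i s c k))].
- by rewrite /expand /=; case: (P s).
- by rewrite expand_cons expand_cat IHg IHh.
- by rewrite expand_cons expand_cat IHg IHh.
Qed.

Variable ok : letter -> {ffun C * option bool -> bool} -> bool.
Variable rens : seq (seq C * (C -> C)).
Variable l0 : letter.

Definition names_template (r : C -> C) (l : seq C) : seq elem :=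
  flatten [seq name_template (r c) (Some false) | c <- l].

Lemma expand_names i s r l :
  expand i s (names_template r l) = flatten [seq write_psym (name (r c) i) | c <- l].
Proof. by elim: l => //= c l IH; rewrite expand_cat expand_name IH /= addn0. Qed.

(** The lone [TVar] on each side writes the empty symbol of the trivial pair. *)
Definition ren_segments (x : seq C * (C -> C)) : seq (segment letter) :=
  [:: Const _ [:: TAnd; TOpen; TVar]; Loop (names_template x.2 x.1);
      Const _ [:: TIncl; TVar]; Loop (names_template id x.1); Const _ [:: TClose]].

Definition phi_segments : seq (segment letter) :=
  Loop (tok TAnd :: template (dnf ok)) ::
  flatten (map ren_segments rens) ++ [:: Const _ (write (inst 0 l0 (STest C predT)))].

Lemma text_cat d (g1 g2 : seq (segment letter)) :
  text l0 d (g1 ++ g2) = text l0 d g1 ++ text l0 d g2.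
Proof. by rewrite /text map_cat flatten_cat. Qed.

Lemma write_foldr_And (I : Type) (F : I -> form) g l :
  write (foldr And g [seq F j | j <- l]) = flatten [seq TAnd :: write (F j) | j <- l] ++ write g.
Proof. by elim: l => //= j l ->; rewrite catA. Qed.

(** Stated for a projection [f], so that it covers both sides of an inclusion atom. *)
Lemma write_ren_pairs d x (f : psym * psym -> psym) (r : C -> C) :
  (forall c i, f (name (x.2 c) i, name c i) = name (r c) i) ->
  segment_text l0 d (Loop (names_template r x.1)) =
  flatten (map write_psym (map f (ren_pairs (size d) x))).
Proof.
move=> fr; rewrite /ren_pairs /= !map_flatten.
elim: (iota 0 _) => //= i l ->; rewrite flatten_cat expand_names -!map_comp.
by congr (flatten _ ++ _); apply: eq_map => c /=; rewrite fr.
Qed.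

Lemma text_phi d : text l0 d phi_segments = write (phi ok rens l0 d).
Proof.
rewrite /phi write_foldr_And /phi_segments -cat1s text_cat; congr (_ ++ _).
  rewrite /text /= cats0; congr flatten; apply: eq_map => i.
  by rewrite expand_cons expand_template.
rewrite write_foldr_And text_cat; congr (_ ++ _).
elim: rens => // x l IH.
have -> : flatten (map ren_segments (x :: l)) =
  ren_segments x ++ flatten (map ren_segments l) by [].
rewrite text_cat IH.
suff -> : text l0 d (ren_segments x) = TAnd :: write (incl (ren_pairs (size d) x)) by [].
have e1 := @write_ren_pairs d x fst x.2 (fun _ _ => erefl).
have e2 := @write_ren_pairs d x snd id (fun _ _ => erefl).
rewrite -[text _ _ _]/([:: TAnd; TOpen; TVar] ++
  segment_text l0 d (Loop (names_template x.2 x.1)) ++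
  [:: TIncl; TVar] ++ segment_text l0 d (Loop (names_template id x.1)) ++ [:: TClose]).
by rewrite e1 e2.
Qed.

End FormulaText.

(** Soundness accepts any model and completeness yields a finite one, so one reduction serves every
    [Q] between the two notions. *)
Lemma satisfiable_reduction (Q : form -> Prop) (A : finType) (L : seq A -> Prop) :
  (forall g, fin_satisfiable g -> Q g) -> (forall g, Q g -> satisfiable g) ->
  EXPTIME L -> PSPACE_reducible L (problem Q).
Proof.
move=> finQ Qsat [M [acc [c MP]]].
pose d x := word c.+1 x : seq (letter A).
exists (fun x => write (sim_formula acc (d x))); split.
  have := @PSPACE_text A c.+1 isT (phi_segments (sim_ok acc) (sim_rens M) None).
  by congr PSPACE_computable; apply/funext => x; rewrite text_phi.
move=> x; have [hf af] := MP x; rewrite -af.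
have -> : run (2 ^ poly_bound c (size x)) (init M x) = conf M x (2 ^ size (d x)).-1.
  (* The machine has halted by time [a], so its configuration at the later time K - 1 is the
     same. *)
  set a := 2 ^ _; set b := _.-1.
  suff ab : a <= b by rewrite /conf -(subnKC ab) run_halted.
  have : a * 2 <= 2 ^ size (d x).
    rewrite mulnC -expnS leq_exp2l// /d /word size_padded ltnS /poly_bound.
    have n1 : size x ^ c <= (size x + 2) ^ c by apply: leq_expn_base; rewrite leq_addr.
    (* With n = |x|, the exponent n ^ c + c is below 2 (n + 2) ^ c <= (n + 2) ^ (c + 1), the number
       of pads. *)
    have n2 : c < (size x + 2) ^ c.
      by apply: leq_trans (ltn_expl c (isT : 1 < 2)) _; apply: leq_expn_base; rewrite leq_addl.
    by rewrite expnS; nia.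
  have : 0 < a by rewrite expn_gt0.
  rewrite /b; lia.
split=> [accf|[g /write_inj <- /Qsat]]; last exact: sim_formula_sound.
by exists (sim_formula acc (d x)) => //; apply/finQ/sim_formula_complete.
Qed.

Theorem theorem2 :
  EXPTIME_hard_PSPACE (problem satisfiable) /\
  EXPTIME_hard_PSPACE (problem fin_satisfiable).
Proof.
have fin_sat g : fin_satisfiable g -> satisfiable g.
  by case=> M [T [_ T0 hT]]; exists M, T.
by split=> A L; apply: satisfiable_reduction.
Qed.
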